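(* Let $k\ge 2$. The beta-transformed linear pool is exchangeably flexibly dispersive relative to the class $\mathcal{C}_I^+$, for every interval $I\subseteq\mathbb{R}$.
   Context: For an interval $I\subseteq\mathbb{R}$, $\mathcal{C}_I^+$ is the class of fixed (non-random) cumulative distribution functions (CDFs) that have support in $I$, are continuous, and are strictly increasing on $I$. The beta-transformed linear pool is the aggregation method $\{G_\theta:\theta\in\Theta\}$ with $\Theta=\Delta_{k-1}\times(0,\infty)^2$, where $\Delta_{k-1}=\{(w_1,\dots,w_k): w_i\ge0,\ \sum_iw_i=1\}$, and, for $\theta=(w_1,\dots,w_k,\alpha,\beta)$, $G_\theta(F_1,\dots,F_k)$ is the CDF $y\mapsto B_{\alpha,\beta}\bigl(\sum_{i=1}^kw_iF_i(y)\bigr)$, with $B_{\alpha,\beta}$ the CDF of the beta distribution with parameters $\alpha>0$, $\beta>0$. A mapping $G_\theta:\mathcal{F}^k\to\mathcal{F}$ (with $\mathcal{F}$ a class of CDFs) is anonymous if $G_\theta(F_{\pi(1)},\dots,F_{\pi(k)})=G_\theta(F_1,\dots,F_k)$ for all $F_1,\dots,F_k\in\mathcal{F}$ and all permutations $\pi$ of $\{1,\dots,k\}$. An aggregation method $\{G_\theta:\theta\in\Theta\}$ of mappings $\mathcal{F}^k\to\mathcal{F}$, $k\ge2$, is exchangeably flexibly dispersive relative to $\mathcal{F}$ if for all $F_0\in\mathcal{F}$ and $F_1,\dots,F_k\in\mathcal{F}$ there exists $\theta\in\Theta$ such that $G_\theta$ is anonymous and, if $\mathcal{L}(Y)=F_0$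 (the real random variable $Y$ has CDF $F_0$), then $G_\theta(F_1,\dots,F_k)$ is neutrally dispersed. A CDF $F$ is neutrally dispersed as a forecast for $Y$ if $\operatorname{var}(Z_F)=\frac1{12}$, where $Z_F=\lim_{y\uparrow Y}F(y)+V\bigl(F(Y)-\lim_{y\uparrow Y}F(y)\bigr)$, with $V$ uniformly distributed on the unit interval and independent of $Y$ (so $Z_F=F(Y)$ when $F$ is continuous). *)

(* Defs.v *)
From HB Require Import structures.
From mathcomp Require Import all_boot all_order all_algebra all_fingroup.
From mathcomp Require Import all_classical all_reals all_analysis.

Set Implicit Arguments.
Unset Strict Implicit.
Unset Printing Implicit Defensive.

Import Order.TTheory GRing.Theory Num.Theory.
Import numFieldNormedType.Exports.

Local Open Scope classical_set_scope.
Local Open Scope ring_scope.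

(** The class $\mathcal{C}_I^+$. A CDF is a plain function [R -> R] that agrees
    with a [cumulativeBounded 0 1]. "Support in I" means that the law with this
    CDF gives [I] mass one; asking for the topological (closed) support to lie
    in [I] would make the class empty for, e.g., an open bounded [I]. *)
Definition cdf_class_plus (R : realType) (I : set R) : set (R -> R) :=
  [set F | exists c : cumulativeBounded (0 : R) (1 : R),
    [/\ F = c :> (R -> R),
        lebesgue_stieltjes_measure c I = 1%E,
        continuous F
      & {in I &, {homo F : x y / x < y}}]].

(** The library's [beta_prob] only covers natural-number parameters. *)
Definition beta_kernel (R : realType) (a b t : R) : R :=
  if 0 < t < 1 then t `^ (a - 1) * (1 - t) `^ (b - 1) else 0.

Definition beta_density (R : realType) (a b t : R) : R :=
  beta_kernel a b t / \int[lebesgue_measure]_(s in `[0, 1]) beta_kernel a b s.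

Definition beta_cdf (R : realType) (a b x : R) : R :=
  \int[lebesgue_measure]_(t in `]-oo, x]) beta_density a b t.

Record blp_parameter (R : realType) (k : nat) := BLPParameter {
  blp_weight : 'I_k -> R;
  blp_alpha : R;
  blp_beta : R;
  blp_weight_ge0 : forall i, 0 <= blp_weight i;
  blp_weight_sum1 : \sum_(i < k) blp_weight i = 1;
  blp_alpha_gt0 : 0 < blp_alpha;
  blp_beta_gt0 : 0 < blp_beta
}.

Definition beta_linear_pool (R : realType) (k : nat)
    (theta : blp_parameter R k) (Fs : 'I_k -> R -> R) : R -> R :=
  fun y => beta_cdf (blp_alpha theta) (blp_beta theta)
             (\sum_(i < k) blp_weight theta i * Fs i y).

(** $G$ maps $\mathcal{F}^k$ into $\mathcal{F}$. *)
Definition maps_class (R : realType) (k : nat) (C : set (R -> R))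
    (G : ('I_k -> R -> R) -> R -> R) : Prop :=
  forall Fs : 'I_k -> R -> R, (forall i, C (Fs i)) -> C (G Fs).

Definition anonymous (R : realType) (k : nat) (C : set (R -> R))
    (G : ('I_k -> R -> R) -> R -> R) : Prop :=
  forall (Fs : 'I_k -> R -> R) (p : 'S_k), (forall i, C (Fs i)) ->
    G (fun i => Fs (p i)) = G Fs.

Definition independent_RVs (R : realType) (d : measure_display)
    (T : measurableType d) (P : probability T R) (X Y : {RV P >-> R}) : Prop :=
  forall A B : set R, measurable A -> measurable B ->
    P (X @^-1` A `&` Y @^-1` B) = (P (X @^-1` A) * P (Y @^-1` B))%E.

Definition has_cdf (R : realType) (d : measure_display)
    (T : measurableType d) (P : probability T R) (Y : {RV P >-> R})
    (F : R -> R) : Prop :=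
  forall y, cdf Y y = (F y)%:E.

Definition uniform01 (R : realType) (d : measure_display)
    (T : measurableType d) (P : probability T R) (V : {RV P >-> R}) : Prop :=
  forall A : set R, measurable A ->
    distribution P V A = uniform_prob (@ltr01 R) A.

(** The (randomized) probability integral transform $Z_F$. *)
Definition pit (R : realType) (T : Type) (F : R -> R) (Y V : T -> R) : T -> R :=
  fun t => let l := lim (F y @[y --> (Y t)^'-]) in l + V t * (F (Y t) - l).

(** [V] is the randomizer entering [pit]; that it is standard uniform and
    independent of [Y] is required where this predicate is used. *)
Definition neutrally_dispersed (R : realType) (d : measure_display)
    (T : measurableType d) (P : probability T R) (F : R -> R)
    (Y V : {RV P >-> R}) : Prop :=
  'V_P[pit F Y V] = (12^-1)%:E.

(** The parameter is chosen from the CDFs alone, before the probability space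
    carrying the outcome and the randomizer. *)
Definition exchangeably_flexibly_dispersive (R : realType) (k : nat)
    (Theta : Type) (G : Theta -> ('I_k -> R -> R) -> R -> R)
    (C : set (R -> R)) : Prop :=
  (forall theta, maps_class C (G theta)) /\
  forall (F0 : R -> R) (Fs : 'I_k -> R -> R),
    C F0 -> (forall i, C (Fs i)) ->
    exists theta : Theta,
      anonymous C (G theta) /\
      forall (d : measure_display) (T : measurableType d)
        (P : probability T R) (Y V : {RV P >-> R}),
        has_cdf Y F0 -> uniform01 V -> independent_RVs Y V ->
        neutrally_dispersed (G theta Fs) Y V.

(* Main.v *)
From HB Require Import structures.
Require Import Defs.
From mathcomp Require Import all_boot all_order all_algebra all_fingroup.
From mathcomp Require Import all_classical all_reals all_analysis.
From mathcomp Require Import measurable_realfun ring lra.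

Set Implicit Arguments.
Unset Strict Implicit.
Unset Printing Implicit Defensive.

Import Order.TTheory GRing.Theory Num.Theory.
Import numFieldNormedType.Exports.

Local Open Scope classical_set_scope.
Local Open Scope ring_scope.

(** The outcome enters only through its law, the Lebesgue-Stieltjes measure of
    [F0]. Since the transformed pool [G] is continuous, the randomised integral
    transform is simply [G \o Y], and the dispersion of [G] is the variance of
    [G] under that law. So the task is to find symmetric weights and beta
    parameters for which this variance is exactly 1/12.

    With equal weights [1/k] the pool is anonymous for every choice of the beta
    parameters. Let [c] be the equally weighted average of the [Fs], [y0] a
    median of [F0] and [m = c y0]. The beta parameters are taken along the ray
    [(s m, s (1 - m))], [s > 0], of beta laws with mean [m]; write [B_s] for the
    corresponding distribution functions.

    - As [s] tends to 0 the beta law splits into two atoms at 0 and 1, hence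
      [B_s] becomes constant on [ ]0, 1[ ]: the total mass of the unnormalised
      density blows up ([beta_mass01_ge]) while its mass on compact subintervals
      stays bounded ([beta_mass_itv_le]). The variance of [B_s (c Y)] tends
      to 0.
    - As [s] tends to infinity the beta law concentrates at [m], because its
      density is a fixed integrable function times a power of
      [t ^ m (1 - t) ^ (1 - m)], which has its strict maximum at [m]. Hence
      [B_s] tends to the indicator of [ ]m, +oo[ ], and the variance tends to
      that of a fair coin, 1/4; this is where the median is used.
    - The variance is continuous in [s], by dominated convergence applied twice:
      to the integral defining [B_s], then to the expectation.

    The intermediate value theorem gives the parameter
    ([exists_beta_variance]).

    That the pool stays inside the class of distribution functions comes from
    the fact that outside [I] all members of the class take the same value, 0
    or 1 ([cdf_class_plus_outside]), which averaging and [B_s] preserve; inside,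
    strict monotonicity is preserved because [B_s] is strictly increasing on
    the unit interval. The same fact shows that where [0 < F0 y < 1], which is
    almost everywhere, every member of the class is strictly monotone at [y]
    ([cdf_class_plus_lt]); thus [m] is the median of [c Y], and [c Y] lies in
    [ ]0, 1[ ] almost surely. *)

(** * An improper fundamental theorem of calculus *)

(** Monotone convergence along the compact intervals [[a + e n, b - e n]], on
    each of which the ordinary theorem applies. Only one-sided limits of the
    primitive are required, so that [f] may be unbounded at both endpoints. *)
Lemma ge0_integral_oo_FTC (R : realType) (f F : R -> R) (a b la lb : R) : a < b ->
  (forall t : R, t \in `]a, b[ -> 0 <= f t) ->
  {in `]a, b[, continuous f} ->
  (forall t : R, t \in `]a, b[ -> is_derive t 1 F (f t)) ->
  F t @[t --> a^'+] --> la -> F t @[t --> b^'-] --> lb ->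
  (\int[lebesgue_measure]_(t in `]a, b[) (f t)%:E = (lb - la)%:E)%E.
Proof.
move=> ab f0 cf dF Fa Fb.
(* [3 e n <= b - a] keeps the segments [A n] below nonempty *)
pose e n : R := (b - a) * n.+3%:R^-1.
have ba0 : 0 < b - a by rewrite subr_gt0.
have e_gt0 n : 0 < e n by rewrite mulr_gt0// invr_gt0.
have e_lt n : a + e n < b - e n.
  have : e n <= (b - a) * 3^-1 by rewrite ler_pM2l// lef_pV2 ?posrE// ler_nat.
  lra.
have ecvg : e n @[n --> \oo] --> (0 : R).
  rewrite -[X in _ --> X](mulr0 (b - a)); apply: cvgM; first exact: cvg_cst.
  have := @cvg_harmonic R; rewrite -(cvg_shiftn 2) /=.
  by apply: cvg_trans; apply: near_eq_cvg; near=> n; rewrite /= addn2.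
pose A n : set R := `[a + e n, b - e n]%classic.
have Asub n : A n `<=` `]a, b[%classic.
  move=> t; rewrite /A /= !in_itv/= => /andP[h1 h2].
  have := e_gt0 n; lra.
have bigA : \bigcup_n A n = `]a, b[%classic.
  apply/seteqP; split => [t [n _ /Asub]//|t /=].
  rewrite in_itv/= => /andP[t0 t1].
  have : 0 < Num.min (t - a) (b - t) by rewrite lt_min !subr_gt0 t0 t1.
  move=> h; have [n _ /(_ n (leqnn _)) hn] := cvgr_lt _ ecvg _ h.
  exists n => //; move: hn; rewrite /A /= in_itv/= lt_min => /andP[]; lra.
have intA n : (\int[lebesgue_measure]_(t in A n) (f t)%:E =
    (F (b - e n) - F (a + e n))%:E)%E.
  have inA t : a + e n <= t <= b - e n -> t \in `]a, b[.
    by move=> h; apply: (Asub n); rewrite /A /= in_itv.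
  have Fc t : a + e n <= t <= b - e n -> F x @[x --> t] --> F t.
    move=> /inA /dF h; apply/differentiable_continuous/derivable1_diffP.
    exact: ex_derive.
  rewrite EFinB; apply: continuous_FTC2 => //.
  - apply: continuous_in_subspaceT => t /[!inE]/= /[!in_itv]/= /inA; exact: cf.
  - split.
    + move=> t /[!in_itv]/= /andP[h1 h2].
      by have [] := dF t (inA t _); rewrite ?(ltW h1) ?(ltW h2).
    + by apply: cvg_at_right_filter; apply: Fc; rewrite lexx ltW.
    + by apply: cvg_at_left_filter; apply: Fc; rewrite lexx ltW.
  - move=> t /[!in_itv]/= /andP[h1 h2].
    have := dF t (inA t _); rewrite derive1E ?(ltW h1) ?(ltW h2) => /(_ isT) h.
    exact: derive_val.
have lim1 : (\int[lebesgue_measure]_(t in A n) (f t)%:E @[n --> \oo] -->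
    \int[lebesgue_measure]_(t in `]a, b[) (f t)%:E)%E.
  rewrite -bigA; apply: ge0_nondecreasing_set_cvg_integral.
  - have e_le m n : (m <= n)%N -> e n <= e m.
      by move=> mn; rewrite ler_pM2l// lef_pV2 ?posrE// ler_nat.
    move=> m n mn; rewrite subsetEset; apply: subset_itv; rewrite !bnd_simp.
    + by rewrite lerD2l e_le.
    + by rewrite lerB// e_le.
  - by move=> n; exact: measurable_itv.
  - move=> n; apply/measurable_EFinP.
    apply: (measurable_funS _ (@Asub n)) => //.
    by apply: open_continuous_measurable_fun => // x; rewrite inE => /cf.
  - by move=> n t /Asub /f0; rewrite lee_fin.
have lim2 : (\int[lebesgue_measure]_(t in A n) (f t)%:E @[n --> \oo] -->
    (lb - la)%:E)%E.
  apply: (@cvg_trans _ ((F (b - e n) - F (a + e n))%:E @[n --> \oo])).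
    by apply: near_eq_cvg; near=> n; rewrite intA.
  apply: cvg_EFin; first by near=> n.
  apply: cvgB.
  - move/cvg_at_leftP : Fb; apply; split => [n|]; first by rewrite ltrBlDr ltrDl.
    rewrite -[X in _ --> X](subr0 b).
    by apply: cvgB => //; exact: cvg_cst.
  - move/cvg_at_rightP : Fa; apply; split => [n|]; first by rewrite ltrDl.
    rewrite -[X in _ --> X](addr0 a).
    by apply: cvgD => //; exact: cvg_cst.
exact: (cvg_unique _ lim1 lim2).
Unshelve. all: by end_near. Qed.

(** * The unnormalised beta density *)

Lemma one_powR (R : realType) (a : R) : 1 `^ a = 1.
Proof. by rewrite powR1. Qed.

Lemma powR_le1 (R : realType) (a x : R) : 0 <= a -> 0 <= x <= 1 -> x `^ a <= 1.
Proof.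
move=> a0 /andP[x0 x1]; rewrite -[leRHS](one_powR a).
by apply: ge0_ler_powR => //; rewrite nnegrE.
Qed.

Lemma continuous_powRl (R : realType) (a t : R) : 0 < t ->
  {for t, continuous (fun x : R => x `^ a)}.
Proof.
move=> t0; apply/differentiable_continuous/derivable1_diffP.
by apply: derivable_powR; rewrite in_itv/= andbT.
Qed.

Lemma continuous_powRl_onem (R : realType) (b t : R) : t < 1 ->
  {for t, continuous (fun x : R => (1 - x) `^ b)}.
Proof.
move=> t1; apply: (@continuous_comp _ _ _ (fun x : R => 1 - x) (fun x : R => x `^ b)).
  by apply: cvgB; [exact: cvg_cst|exact: cvg_id].
by apply: continuous_powRl; rewrite subr_gt0.
Qed.

Lemma integral01_powR (R : realType) (a : R) : 0 < a ->
  (\int[lebesgue_measure]_(t in `]0%R, 1%R[) (t `^ (a - 1))%:E = (a^-1)%:E)%E.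
Proof.
move=> a0; have an0 : a != 0 by rewrite gt_eqF.
rewrite -[X in X%:E](subr0 a^-1).
apply: (@ge0_integral_oo_FTC _ _ (fun t : R => a^-1 * t `^ a) 0 1).
- exact: ltr01.
- by move=> t _; exact: powR_ge0.
- by move=> t /[!in_itv]/= /andP[t0 _]; exact: continuous_powRl.
- move=> t /[!in_itv]/= /andP[t0 _].
  have -> : t `^ (a - 1) = a^-1 *: (a * t `^ (a - 1)) by rewrite scalerA mulVf// scale1r.
  exact: (is_deriveZ a^-1 (is_derive1_powR a t0)).
- rewrite -[X in _ --> X](mulr0 a^-1); apply: cvgM; first exact: cvg_cst.
  exact: powR_cvg0.
- apply: cvg_at_left_filter; rewrite -[X in _ --> X]mulr1 -[X in _ * X](one_powR a).
  by apply: cvgM; [exact: cvg_cst|exact: (@continuous_powRl _ a 1)].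
Qed.

Lemma integral01_powR_onem (R : realType) (b : R) : 0 < b ->
  (\int[lebesgue_measure]_(t in `]0%R, 1%R[) ((1 - t) `^ (b - 1))%:E = (b^-1)%:E)%E.
Proof.
move=> b0; have bn0 : b != 0 by rewrite gt_eqF.
rewrite -[X in X%:E]opprK -(sub0r (- b^-1)).
apply: (@ge0_integral_oo_FTC _ _ (fun t : R => - b^-1 * (1 - t) `^ b) 0 1).
- exact: ltr01.
- by move=> t _; exact: powR_ge0.
- by move=> t /[!in_itv]/= /andP[_ t1]; exact: continuous_powRl_onem.
- move=> t /[!in_itv]/= /andP[_ t1].
  have h : is_derive t (1 : R) (fun x : R => 1 - x) (-1).
    have h := is_deriveB (is_derive_cst (1:R) t (1:R)) (is_derive_id t (1:R)).
    by apply: (is_derive_eq h); rewrite add0r.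
  have h1 : is_derive (1 - t) (1 : R) (fun x : R => x `^ b) (b * (1 - t) `^ (b - 1)).
    by apply: is_derive1_powR; rewrite subr_gt0.
  have h2 := is_deriveZ (- b^-1)
    (@is_derive1_comp _ (fun x : R => x `^ b) (fun x => 1 - x) _ _ _ h1 h).
  by apply: (is_derive_eq h2); rewrite /GRing.scale/=; field.
- apply: cvg_at_right_filter; rewrite -[X in _ --> X]mulr1.
  rewrite -[X in _ * X](one_powR b) -[X in X `^ b](subr0 1).
  by apply: cvgM; [exact: cvg_cst|exact: (@continuous_powRl_onem _ b 0)].
- rewrite -[X in _ --> X](mulr0 (- b^-1)); apply: cvgM; first exact: cvg_cst.
  apply/cvg_at_leftP => u [u1 ucvg].
  have := @powR_cvg0 R b b0 => /cvg_at_rightP; apply; split => [n|].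
    by rewrite subr_gt0.
  by rewrite -(subrr 1); apply: cvgB => //; exact: cvg_cst.
Qed.

Lemma beta_kernel_ge0 (R : realType) (a b t : R) : 0 <= beta_kernel a b t.
Proof. by rewrite /beta_kernel; case: ifP => // _; rewrite mulr_ge0// powR_ge0. Qed.

Lemma beta_kernelE (R : realType) (a b t : R) : 0 < t < 1 ->
  beta_kernel a b t = t `^ (a - 1) * (1 - t) `^ (b - 1).
Proof. by rewrite /beta_kernel => ->. Qed.

Lemma beta_kernel0 (R : realType) (a b t : R) : ~~ (0 < t < 1) ->
  beta_kernel a b t = 0.
Proof. by rewrite /beta_kernel => /negbTE ->. Qed.

Lemma measurable_beta_kernel (R : realType) (a b : R) :
  measurable_fun [set: R] (beta_kernel a b).
Proof.
have -> : beta_kernel a b =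
    (fun t => t `^ (a - 1) * (1 - t) `^ (b - 1)) \_ `]0, 1[%classic.
  apply/funext => t; rewrite patchE /beta_kernel.
  by case: ifPn => h; [rewrite mem_set//= in_itv|rewrite memNset//= in_itv; exact/negP].
apply/(measurable_restrictT _ _).1 => //.
apply: measurable_funTS; apply: measurable_funM; first exact: measurable_powR.
apply: (@measurableT_comp _ _ _ _ _ _ (fun x : R => x `^ (b - 1))).
  exact: measurable_powR.
by apply: measurable_funB => //; exact: measurable_id.
Qed.

(** From [1 = t + (1 - t)]: the kernel is
    [t ^ (a - 1) (1 - t) ^ b + t ^ a (1 - t) ^ (b - 1)], and powers with a
    nonnegative exponent are at most 1 on the unit interval. This separates the
    singularities at 0 and 1. *)
Lemma beta_kernel_le (R : realType) (a b t : R) : 0 < a -> 0 < b ->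
  0 < t < 1 -> beta_kernel a b t <= t `^ (a - 1) + (1 - t) `^ (b - 1).
Proof.
move=> a0 b0 t01; rewrite beta_kernelE//; case/andP : t01 => t0 t1.
have s0 : 0 < 1 - t by rewrite subr_gt0.
have ta : t * t `^ (a - 1) <= 1.
  by rewrite mulr_powRB1// ?(ltW t0)// powR_le1// ?(ltW t0) ?(ltW t1) ?(ltW a0).
have sb : (1 - t) * (1 - t) `^ (b - 1) <= 1.
  rewrite mulr_powRB1// ?(ltW s0)// powR_le1 ?(ltW s0) ?(ltW b0)//=; lra.
have := powR_ge0 t (a - 1); have := powR_ge0 (1 - t) (b - 1).
move: (t `^ (a - 1)) (_ `^ (b - 1)) ta sb => x y; nra.
Qed.

Lemma integrable_beta_kernel (R : realType) (a b : R) (A : set R) :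
  0 < a -> 0 < b -> measurable A ->
  lebesgue_measure.-integrable A (EFin \o beta_kernel a b).
Proof.
move=> a0 b0 mA; apply: (@integrableS _ _ _ _ setT) => //.
have i1 : lebesgue_measure.-integrable `]0, 1[%classic
    (EFin \o (fun t : R => t `^ (a - 1))).
  apply/integrableP; split.
    by apply/measurable_EFinP/measurable_funTS; exact: measurable_powR.
  under eq_integral => t _ do rewrite /= ger0_norm ?powR_ge0//.
  by rewrite integral01_powR// ltry.
have i2 : lebesgue_measure.-integrable `]0, 1[%classic
    (EFin \o (fun t : R => (1 - t) `^ (b - 1))).
  apply/integrableP; split.
    apply/measurable_EFinP/measurable_funTS.
    apply: (@measurableT_comp _ _ _ _ _ _ (fun x : R => x `^ (b - 1))).
      exact: measurable_powR.
    by apply: measurable_funB => //; exact: measurable_id.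
  under eq_integral => t _ do rewrite /= ger0_norm ?powR_ge0//.
  by rewrite integral01_powR_onem// ltry.
have -> : EFin \o beta_kernel a b = (EFin \o beta_kernel a b) \_ `]0, 1[%classic.
  apply/funext => t; rewrite patchE /=; case: ifPn => //.
  by rewrite notin_setE/= in_itv/= => /negP h; rewrite beta_kernel0.
apply/integrable_restrict => //; rewrite ?setTI//.
apply: le_integrable (integrableD _ i1 i2) => //.
  by apply/measurable_EFinP/measurable_funTS; exact: measurable_beta_kernel.
move=> t /=; rewrite in_itv/= => t01; rewrite lee_fin.
rewrite !ger0_norm ?addr_ge0 ?powR_ge0 ?beta_kernel_ge0//.
exact: beta_kernel_le.
Qed.

Definition beta_mass (R : realType) (a b : R) (A : set R) : R :=
  \int[lebesgue_measure]_(t in A) beta_kernel a b t.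

Lemma beta_mass_ge0 (R : realType) (a b : R) (A : set R) : 0 <= beta_mass a b A.
Proof. by apply: Rintegral_ge0 => t _; exact: beta_kernel_ge0. Qed.

Lemma le_beta_mass (R : realType) (a b : R) (A B : set R) : 0 < a -> 0 < b ->
  measurable A -> measurable B -> A `<=` B -> beta_mass a b A <= beta_mass a b B.
Proof.
move=> a0 b0 mA mB AB; apply: fine_le.
- exact/integrable_fin_num/integrable_beta_kernel.
- exact/integrable_fin_num/integrable_beta_kernel.
- apply: ge0_subset_integral => //.
    by apply/measurable_EFinP/measurable_funTS; exact: measurable_beta_kernel.
  by move=> t _; rewrite lee_fin beta_kernel_ge0.
Qed.

Lemma eq_beta_mass (R : realType) (a b : R) (A B : set R) :
  A `&` `]0, 1[ = B `&` `]0, 1[ -> beta_mass a b A = beta_mass a b B.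
Proof.
move=> AB; rewrite /beta_mass Rintegral_mkcond [RHS]Rintegral_mkcond.
apply: eq_Rintegral => t _; rewrite !patchE.
have [t01|t01] := boolP (0 < t < 1); last by rewrite beta_kernel0// !if_same.
have h : (A `&` `]0, 1[) t = (B `&` `]0, 1[) t by rewrite AB.
have t01' : `]0, 1[%classic t by rewrite /= in_itv.
suff -> : (t \in A) = (t \in B) by [].
apply/idP/idP; rewrite !inE => ht.
  by have : (A `&` `]0, 1[) t by []; rewrite h => -[].
by have : (B `&` `]0, 1[) t by []; rewrite -h => -[].
Qed.

Lemma integrable_cst_itvcc (R : realType) (c u v : R) :
  lebesgue_measure.-integrable `[u, v] (EFin \o (fun=> c)).
Proof.
apply: continuous_compact_integrable; first exact: segment_compact.
by apply: continuous_subspaceT; exact: cst_continuous.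
Qed.

Lemma Rintegral_cst_itvcc (R : realType) (c u v : R) : u <= v ->
  \int[lebesgue_measure]_(t in `[u, v]) c = c * (v - u).
Proof.
move=> uv; rewrite Rintegral_cst//; congr (_ * _).
transitivity (fine (lebesgue_measure (`[u, v]%classic : set R))) => //.
rewrite lebesgue_measure_itv/= lte_fin.
case: ltP => //= vu; have -> : v = u by apply/eqP; rewrite eq_le uv vu.
by rewrite subrr.
Qed.

(** Dropping the [- 1] from the exponents decreases the kernel and makes each
    factor monotone on the unit interval, so that it is bounded below by its
    value at an endpoint. *)
Lemma beta_mass_itv_ge (R : realType) (a b u v : R) : 0 < a -> 0 < b ->
  0 < u -> u <= v -> v < 1 ->
  u `^ a * (1 - v) `^ b * (v - u) <= beta_mass a b `[u, v].
Proof.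
move=> a0 b0 u0 uv v1.
have -> : u `^ a * (1 - v) `^ b * (v - u) =
    \int[lebesgue_measure]_(t in `[u, v]) (u `^ a * (1 - v) `^ b).
  by rewrite Rintegral_cst_itvcc.
apply: le_Rintegral => //.
- exact: integrable_cst_itvcc.
- exact: integrable_beta_kernel.
move=> t /=; rewrite in_itv/= => /andP[ut tv].
have t0 : 0 < t by exact: lt_le_trans ut.
have t1 : t < 1 by exact: le_lt_trans v1.
rewrite beta_kernelE ?t0//; apply: ler_pM; rewrite ?powR_ge0//.
- apply: (@le_trans _ _ (t `^ a)).
    by apply: ge0_ler_powR; rewrite ?nnegrE ?(ltW a0) ?(ltW u0) ?(ltW t0).
  by apply: ger_powR; [rewrite t0 ltW|rewrite gerBl].
- apply: (@le_trans _ _ ((1 - t) `^ b)).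
    by apply: ge0_ler_powR; rewrite ?nnegrE ?subr_ge0 ?(ltW b0) ?(ltW v1) ?(ltW t1)//
      lerB.
  by apply: ger_powR; [rewrite subr_gt0 t1 gerBl ltW|rewrite gerBl].
Qed.

Lemma beta_mass_itv_gt0 (R : realType) (a b u v : R) : 0 < a -> 0 < b ->
  0 < u -> u < v -> v < 1 -> 0 < beta_mass a b `[u, v].
Proof.
move=> a0 b0 u0 uv v1; apply: lt_le_trans (beta_mass_itv_ge a0 b0 u0 (ltW uv) v1).
by rewrite !mulr_gt0 ?powR_gt0 ?subr_gt0.
Qed.

(** The bound does not depend on [a] and [b]: the kernel is at most its value at
    [a = b = 0]. This uniformity makes the beta law lose all its mass inside the
    unit interval when [a] and [b] tend to 0. *)
Lemma beta_mass_itv_le (R : realType) (a b u v : R) : 0 < a -> 0 < b ->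
  0 < u -> u <= v -> v < 1 ->
  beta_mass a b `[u, v] <= (u * (1 - v))^-1.
Proof.
move=> a0 b0 u0 uv v1.
have c0 : 0 < (u * (1 - v))^-1 by rewrite invr_gt0 mulr_gt0 ?subr_gt0.
apply: (@le_trans _ _ (\int[lebesgue_measure]_(t in `[u, v]) (u * (1 - v))^-1)).
  apply: le_Rintegral => //.
  - exact: integrable_beta_kernel.
  - exact: integrable_cst_itvcc.
  move=> t /=; rewrite in_itv/= => /andP[ut tv].
  have t0 : 0 < t by exact: lt_le_trans ut.
  have t1 : t < 1 by exact: le_lt_trans v1.
  rewrite beta_kernelE ?t0// invfM; apply: ler_pM; rewrite ?powR_ge0//.
  - apply: (@le_trans _ _ (t `^ (-1))).
      by apply: ger_powR; [rewrite t0 ltW|rewrite lerDr ltW].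
    by rewrite powR_inv1 ?(ltW t0)// lef_pV2 ?posrE.
  - apply: (@le_trans _ _ ((1 - t) `^ (-1))).
      by apply: ger_powR; [rewrite subr_gt0 t1 gerBl ltW|rewrite lerDr ltW].
    by rewrite powR_inv1 ?subr_ge0 ?(ltW t1)// lef_pV2 ?posrE ?subr_gt0// lerB.
by rewrite Rintegral_cst_itvcc// ler_piMr ?(ltW c0)//; lra.
Qed.

Lemma beta_mass01_gt0 (R : realType) (a b : R) : 0 < a -> 0 < b ->
  0 < beta_mass a b `[0, 1].
Proof.
move=> a0 b0; have := @beta_mass_itv_gt0 R a b (1 / 3) (2 / 3) a0 b0.
move=> h; apply: (lt_le_trans (h _ _ _)); [lra|lra|lra|].
apply: le_beta_mass => // t /=; rewrite !in_itv/= => /andP[]; lra.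
Qed.

(** For [b <= 1] the factor [(1 - t) ^ (b - 1)] is at least 1, and the other
    factor integrates to [a^-1]. *)
Lemma beta_mass01_ge (R : realType) (a b : R) : 0 < a -> 0 < b -> b <= 1 ->
  a^-1 <= beta_mass a b `[0, 1].
Proof.
move=> a0 b0 b1; rewrite -lee_fin -integral01_powR// /beta_mass.
rewrite [leRHS](_ : _ =
    \int[lebesgue_measure]_(t in `[0%R, 1%R]) (beta_kernel a b t)%:E)%E; last first.
  by rewrite fineK//; exact/integrable_fin_num/integrable_beta_kernel.
apply: (@le_trans _ _
    (\int[lebesgue_measure]_(t in `]0%R, 1%R[) (beta_kernel a b t)%:E)%E).
  apply: ge0_le_integral => //.
  - by move=> t _; rewrite lee_fin powR_ge0.
  - by apply/measurable_EFinP/measurable_funTS; exact: measurable_powR.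
  - by apply/measurable_EFinP/measurable_funTS; exact: measurable_beta_kernel.
  move=> t /=; rewrite in_itv/= => /andP[t0 t1].
  rewrite lee_fin beta_kernelE ?t0// ler_peMr ?powR_ge0//.
  rewrite -[leLHS](powRr0 (1 - t)); apply: ger_powR; last by rewrite subr_le0.
  by rewrite subr_gt0 t1 gerBl ltW.
apply: ge0_subset_integral => //.
- by apply/measurable_EFinP/measurable_funTS; exact: measurable_beta_kernel.
- by move=> t _; rewrite lee_fin beta_kernel_ge0.
- exact: subset_itv_oo_cc.
Qed.

(** * The beta distribution function *)

Lemma beta_cdfE (R : realType) (a b x : R) : 0 < a -> 0 < b ->
  beta_cdf a b x = beta_mass a b `]-oo, x] / beta_mass a b `[0, 1].
Proof.
by move=> a0 b0; rewrite -RintegralZr//; exact: integrable_beta_kernel.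
Qed.

Lemma beta_cdfB (R : realType) (a b x y : R) : 0 < a -> 0 < b -> x <= y ->
  beta_cdf a b y - beta_cdf a b x = beta_mass a b `]x, y] / beta_mass a b `[0, 1].
Proof.
move=> a0 b0 xy; rewrite !beta_cdfE// -mulrBl; congr (_ / _).
by apply: Rintegral_itvB => //; exact: integrable_beta_kernel.
Qed.

Lemma beta_cdf_le0 (R : realType) (a b x : R) : 0 < a -> 0 < b -> x <= 0 ->
  beta_cdf a b x = 0.
Proof.
move=> a0 b0 x0; rewrite beta_cdfE// (@eq_beta_mass _ _ _ _ set0).
  by rewrite /beta_mass Rintegral_set0 mul0r.
rewrite set0I -subset0 => t [/=]; rewrite !in_itv/= => tx /andP[]; lra.
Qed.

Lemma beta_cdf_ge1 (R : realType) (a b x : R) : 0 < a -> 0 < b -> 1 <= x ->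
  beta_cdf a b x = 1.
Proof.
move=> a0 b0 x1; rewrite beta_cdfE// (@eq_beta_mass _ _ _ _ `[0, 1]%classic).
  by rewrite divff// gt_eqF// beta_mass01_gt0.
by apply/seteqP; split=> t [/=]; rewrite !in_itv/= => h1 /andP[h2 h3]; split=> //;
  rewrite ?h2//; lra.
Qed.

Lemma beta_cdf_nondecreasing (R : realType) (a b : R) : 0 < a -> 0 < b ->
  {homo beta_cdf a b : x y / x <= y}.
Proof.
move=> a0 b0 x y xy; rewrite -subr_ge0 beta_cdfB// divr_ge0 ?beta_mass_ge0//.
Qed.

Lemma beta_cdf_itv01 (R : realType) (a b x : R) : 0 < a -> 0 < b ->
  0 <= beta_cdf a b x <= 1.
Proof.
move=> a0 b0; apply/andP; split.
  have [x0|/ltW x0] := leP x 0; first by rewrite beta_cdf_le0.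
  by rewrite -(beta_cdf_le0 a0 b0 (lexx 0)) beta_cdf_nondecreasing.
have [x1|/ltW x1] := leP 1 x; first by rewrite beta_cdf_ge1.
by rewrite -(beta_cdf_ge1 a0 b0 (lexx 1)) beta_cdf_nondecreasing.
Qed.

Lemma beta_cdf_increasing (R : realType) (a b : R) : 0 < a -> 0 < b ->
  {in `[0, 1] &, {homo beta_cdf a b : x y / x < y}}.
Proof.
move=> a0 b0 x y; rewrite !in_itv/= => /andP[x0 x1] /andP[y0 y1] xy.
rewrite -subr_gt0 beta_cdfB ?(ltW xy)// divr_gt0 ?beta_mass01_gt0//.
apply: (@lt_le_trans _ _ (beta_mass a b `[x + (y - x) / 3, x + (y - x) / 2])).
  by apply: beta_mass_itv_gt0 => //; lra.
apply: le_beta_mass => // t /=; rewrite !in_itv/= => /andP[]; lra.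
Qed.

(** An integral over a segment [[u, v]] is continuous in its upper bound. The
    kernel vanishes outside the unit interval, so [u <= 0] may replace the
    infinite lower bound. *)
Lemma continuous_beta_cdf (R : realType) (a b : R) : 0 < a -> 0 < b ->
  continuous (beta_cdf a b).
Proof.
move=> a0 b0 x; pose u : R := - `|x| - 1; pose v : R := `|x| + 1.
have ux : u < x by have := ler_norm (- x); rewrite normrN /u; lra.
have xv : x < v by have := ler_norm x; rewrite /v; lra.
have uv : u <= v by apply: ltW; exact: lt_trans xv.
have u0 : u <= 0 by have := normr_ge0 x; rewrite /u; lra.
have E : beta_cdf a b = fun y =>
    parameterized_integral lebesgue_measure u y (beta_kernel a b) /
    beta_mass a b `[0, 1].
  apply/funext => y; rewrite beta_cdfE//; congr (_ / _).
  apply: eq_beta_mass; apply/seteqP; split=> t [/=]; rewrite !in_itv/= => h1 /andP[h2 h3];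
    split => //; rewrite ?h2//; lra.
rewrite E; apply: cvgM; last exact: cvg_cst.
have ik : lebesgue_measure.-integrable `[u, v] (EFin \o beta_kernel a b).
  exact: integrable_beta_kernel.
have := parameterized_integral_continuous uv ik.
move=> /continuous_within_itvP; rewrite (lt_trans ux xv) => /(_ isT)[+ _ _].
by apply; rewrite in_itv/= ux xv.
Qed.

(** * Beta laws of fixed mean: dependence on the precision *)

(** The beta law with mean [m] and precision [s], the sum of its two shape
    parameters. *)
Definition beta_cdf_mp (R : realType) (m s x : R) : R :=
  beta_cdf (s * m) (s * (1 - m)) x.

Lemma continuous_powR_affine (R : realType) (c t : R) : 0 < t ->
  continuous (fun r : R => t `^ (c * r - 1)).
Proof.
move=> t0 r.
have -> : (fun r : R => t `^ (c * r - 1)) = (fun r => expR ((c * r - 1) * ln t)).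
  by apply/funext => z; rewrite /powR gt_eqF.
apply: (@continuous_comp _ _ _ (fun r : R => (c * r - 1) * ln t) expR);
  last exact: continuous_expR.
apply: cvgM; last exact: cvg_cst.
by apply: cvgB; [apply: cvgM; [exact: cvg_cst|exact: cvg_id]|exact: cvg_cst].
Qed.

Lemma continuous_beta_kernel_mp (R : realType) (m t : R) :
  continuous (fun s : R => beta_kernel (s * m) (s * (1 - m)) t).
Proof.
have [t01|t01] := boolP (0 < t < 1); last first.
  have -> : (fun s : R => beta_kernel (s * m) (s * (1 - m)) t) = cst 0.
    by apply/funext => s; rewrite beta_kernel0.
  exact: cst_continuous.
have -> : (fun s : R => beta_kernel (s * m) (s * (1 - m)) t) =
    (fun s => t `^ (m * s - 1) * (1 - t) `^ ((1 - m) * s - 1)).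
  by apply/funext => s; rewrite beta_kernelE// [s * m]mulrC [s * (1 - m)]mulrC.
case/andP: t01 => t0 t1 s.
by apply: cvgM; apply: continuous_powR_affine; rewrite ?subr_gt0.
Qed.

(** As functions of the precision both factors are powers of a base in the unit
    interval. Hence the kernel at a small precision dominates all later ones. *)
Lemma beta_kernel_mp_nonincreasing (R : realType) (m t : R) : 0 < m < 1 ->
  {homo (fun s : R => beta_kernel (s * m) (s * (1 - m)) t) : s r / s <= r >-> r <= s}.
Proof.
move=> /andP[m0 m1] s r sr; have n0 : 0 < 1 - m by rewrite subr_gt0.
have [t01|t01] := boolP (0 < t < 1); last by rewrite !beta_kernel0.
rewrite !beta_kernelE//; case/andP: t01 => t0 t1.
apply: ler_pM; rewrite ?powR_ge0//; apply: ger_powR.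
- by rewrite t0 ltW.
- by rewrite lerB// ler_pM2r.
- by rewrite subr_gt0 t1 gerBl ltW.
- by rewrite lerB// ler_pM2r.
Qed.

Lemma continuous_beta_mass_mp (R : realType) (m : R) (A : set R) : 0 < m < 1 ->
  measurable A ->
  {in `]0, +oo[, continuous (fun s : R => beta_mass (s * m) (s * (1 - m)) A)}.
Proof.
move=> m01 mA s; rewrite in_itv/= andbT => s0.
have [m0 m1] := andP m01; have n0 : 0 < 1 - m by rewrite subr_gt0.
have ik r : 0 < r -> lebesgue_measure.-integrable A
    (EFin \o beta_kernel (r * m) (r * (1 - m))).
  by move=> r0; apply: integrable_beta_kernel => //; rewrite mulr_gt0.
have u0 : 0 < s / 2 by rewrite divr_gt0.
(* the kernel at precision [s / 2] dominates near [s] *)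
apply: (@continuity_under_integral R _ _ lebesgue_measure
  (fun r => beta_kernel (r * m) (r * (1 - m))) A mA (s / 2) (s + 1) _ _
  (beta_kernel (s / 2 * m) (s / 2 * (1 - m)))).
- by move=> r /=; rewrite in_itv/= => /andP[h _]; apply: ik; exact: lt_trans h.
- by apply: aeW => /= t _ r _; exact: continuous_beta_kernel_mp.
- exact: ik.
- move=> r; rewrite /= in_itv/= => /andP[/ltW h _]; apply: aeW => /= t _.
  by rewrite ger0_norm ?beta_kernel_ge0//; exact: beta_kernel_mp_nonincreasing.
- by rewrite inE/= in_itv/=; lra.
Qed.

Lemma continuous_beta_cdf_mp (R : realType) (m x : R) : 0 < m < 1 ->
  {in `]0, +oo[, continuous (fun s => beta_cdf_mp m s x)}.
Proof.
move=> m01 s; rewrite in_itv/= andbT => s0.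
have [m0 m1] := andP m01; have n0 : 0 < 1 - m by rewrite subr_gt0.
have E r : 0 < r -> beta_cdf_mp m r x =
    beta_mass (r * m) (r * (1 - m)) `]-oo, x] / beta_mass (r * m) (r * (1 - m)) `[0, 1].
  by move=> r0; rewrite -beta_cdfE ?mulr_gt0.
have cm A : measurable A -> beta_mass (r * m) (r * (1 - m)) A @[r --> s] -->
    beta_mass (s * m) (s * (1 - m)) A.
  by move=> mA; apply: continuous_beta_mass_mp; rewrite ?in_itv/= ?andbT.
have lim : beta_mass (r * m) (r * (1 - m)) `]-oo, x] /
    beta_mass (r * m) (r * (1 - m)) `[0, 1] @[r --> s] --> beta_cdf_mp m s x.
  rewrite E//; apply: cvgM; first exact: cm.
  by apply: cvgV; [rewrite gt_eqF// beta_mass01_gt0// mulr_gt0|exact: cm].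
apply: cvg_trans lim.
by apply: near_eq_cvg; near=> r; rewrite E//; near: r; exact: lt_nbhsr.
Unshelve. all: by end_near. Qed.

(** * Beta laws of fixed mean: vanishing and infinite precision *)

(** The increment between two interior points is a bounded mass divided by a
    total mass of order at least [1 / s], with [s = 1 / (n + 1)]. *)
Lemma beta_cdf_mp_flat (R : realType) (m x y : R) : 0 < m < 1 ->
  0 < x -> x <= y -> y < 1 ->
  beta_cdf_mp m n.+1%:R^-1 y - beta_cdf_mp m n.+1%:R^-1 x @[n --> \oo] --> (0 : R).
Proof.
move=> /andP[m0 m1] x0 xy y1; have n0 : 0 < 1 - m by rewrite subr_gt0.
pose C := (x * (1 - y))^-1 * m.
have lim : C * n.+1%:R^-1 @[n --> \oo] --> (0 : R).
  rewrite -[X in _ --> X](mulr0 C); apply: cvgM; first exact: cvg_cst.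
  exact: cvg_harmonic.
apply: (squeeze_cvgr _ (cvg_cst 0) lim); near=> n.
set s : R := n.+1%:R^-1.
have s0 : 0 < s by rewrite invr_gt0.
have s1 : s <= 1 by rewrite invf_le1// ler1n.
have a0 : 0 < s * m by rewrite mulr_gt0.
have b0 : 0 < s * (1 - m) by rewrite mulr_gt0.
apply/andP; split; first by rewrite subr_ge0 beta_cdf_nondecreasing.
have c0 : 0 < x * (1 - y) by rewrite mulr_gt0// subr_gt0.
rewrite beta_cdfB// /C -mulrA; apply: ler_pM.
- exact: beta_mass_ge0.
- by rewrite invr_ge0 beta_mass_ge0.
- apply: le_trans (beta_mass_itv_le a0 b0 x0 xy y1).
  by apply: le_beta_mass => //; exact: subset_itv_oc_cc.
- rewrite -[leRHS]invrK lef_pV2 ?posrE ?invr_gt0 ?mulr_gt0 ?beta_mass01_gt0//.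
  rewrite [m * s]mulrC; apply: beta_mass01_ge => //.
  by rewrite mulr_ile1 ?(ltW s0) ?(ltW n0)//; lra.
Unshelve. all: by end_near. Qed.

(** The logarithm of [t ^ m (1 - t) ^ (1 - m)] is concave with maximum at [m].
    The inequality [ln z <= z - 1], applied to [x / y] and to
    [(1 - x) / (1 - y)], bounds the difference of the logarithms by
    [(x - y) (m - y) / (y (1 - y))], which is negative as soon as [y] lies
    strictly between [x] and [m]. *)
Lemma beta_mode_lt (R : realType) (m x y : R) : 0 < m < 1 ->
  0 < x < 1 -> 0 < y < 1 -> (x < y < m) || (m < y < x) ->
  x `^ m * (1 - x) `^ (1 - m) < y `^ m * (1 - y) `^ (1 - m).
Proof.
move=> /andP[m0 m1] /andP[x0 x1] /andP[y0 y1] yxm.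
have x2 : 0 < 1 - x by rewrite subr_gt0.
have y2 : 0 < 1 - y by rewrite subr_gt0.
have nm : 0 < 1 - m by rewrite subr_gt0.
rewrite -ltr_ln ?posrE ?mulr_gt0 ?powR_gt0// !lnM ?posrE ?powR_gt0// !ln_powR.
have h1 : ln x - ln y <= x / y - 1.
  rewrite -ln_div ?posrE//; have := @le_ln1Dx R (x / y - 1).
  by rewrite subrKC; apply; rewrite ltrBrDr addNr divr_gt0.
have h2 : ln (1 - x) - ln (1 - y) <= (1 - x) / (1 - y) - 1.
  rewrite -ln_div ?posrE//; have := @le_ln1Dx R ((1 - x) / (1 - y) - 1).
  by rewrite subrKC; apply; rewrite ltrBrDr addNr divr_gt0.
rewrite -subr_lt0.
have -> : m * ln x + (1 - m) * ln (1 - x) - (m * ln y + (1 - m) * ln (1 - y)) =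
  m * (ln x - ln y) + (1 - m) * (ln (1 - x) - ln (1 - y)) by ring.
apply: (@le_lt_trans _ _ (m * (x / y - 1) + (1 - m) * ((1 - x) / (1 - y) - 1))).
  by rewrite lerD// ler_pM2l.
have -> : m * (x / y - 1) + (1 - m) * ((1 - x) / (1 - y) - 1) =
    - ((x - y) * (y - m)) / (y * (1 - y)).
  by field; rewrite !gt_eqF.
rewrite pmulr_llt0 ?invr_gt0 ?mulr_gt0// oppr_lt0.
case/orP: yxm => /andP[h3 h4].
  by rewrite nmulr_rgt0 ?subr_lt0.
by rewrite pmulr_rgt0 ?subr_gt0.
Qed.

Lemma beta_kernel_mpS (R : realType) (m t : R) (n : nat) : 0 < t < 1 ->
  beta_kernel (n.+1%:R * m) (n.+1%:R * (1 - m)) t =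
  (t `^ m * (1 - t) `^ (1 - m)) ^+ n * beta_kernel m (1 - m) t.
Proof.
move=> t01; rewrite !beta_kernelE//; case/andP: t01 => t0 t1.
have t2 : 0 < 1 - t by rewrite subr_gt0.
have E (x c : R) : 0 < x -> x `^ (n.+1%:R * c - 1) = (x `^ c) ^+ n * x `^ (c - 1).
  move=> x0; rewrite -powR_mulrn ?powR_ge0// -powRrM.
  rewrite -powRD; last by rewrite (gt_eqF x0) implybT.
  by congr (_ `^ _); rewrite -natr1; ring.
by rewrite !E// exprMn; ring.
Qed.

Lemma beta_mode_le (R : realType) (m x y : R) : 0 < m < 1 ->
  0 < x < 1 -> 0 < y < 1 -> (x <= y < m) || (m < y <= x) ->
  x `^ m * (1 - x) `^ (1 - m) <= y `^ m * (1 - y) `^ (1 - m).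
Proof.
move=> m01 x01 y01; have [->//|xy h] := eqVneq x y.
apply/ltW/beta_mode_lt => //; case/orP: h => /andP[h1 h2]; apply/orP.
  by left; rewrite h2 lt_neqAle xy h1.
by right; rewrite h1 lt_neqAle eq_sym xy h2.
Qed.

(** Raising the precision from 1 to [n + 1] multiplies the kernel by the [n]-th
    power of [t ^ m (1 - t) ^ (1 - m)]. If this function is at most [p] on [A]
    and at least [q > p] on an interval, then the proportion of the mass lying
    in [A] is at most a constant times [(p / q) ^ n]. *)
Lemma beta_mass_concentrate (R : realType) (m p q u v : R) (A : set R) :
  0 < m < 1 -> measurable A -> 0 < u -> u < v -> v < 1 -> 0 <= p -> p < q ->
  (forall t, A t -> 0 < t < 1 -> t `^ m * (1 - t) `^ (1 - m) <= p) ->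
  (forall t, u <= t <= v -> q <= t `^ m * (1 - t) `^ (1 - m)) ->
  beta_mass (n.+1%:R * m) (n.+1%:R * (1 - m)) A /
  beta_mass (n.+1%:R * m) (n.+1%:R * (1 - m)) `[0, 1] @[n --> \oo] --> (0 : R).
Proof.
move=> /andP[m0 m1] mA u0 uv v1 p0 pq hp hq.
have n0 : 0 < 1 - m by rewrite subr_gt0.
have q0 : 0 < q by exact: le_lt_trans pq.
pose C := beta_mass m (1 - m) A / beta_mass m (1 - m) `[u, v].
have lim : C * (p / q) ^+ n @[n --> \oo] --> (0 : R).
  apply: (@cvg_geometric R C (p / q)).
  by rewrite ger0_norm ?divr_ge0// ?(ltW q0)// ltr_pdivrMr// mul1r.
apply: (squeeze_cvgr _ (cvg_cst 0) lim); near=> n.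
rewrite divr_ge0 ?beta_mass_ge0//=.
have iK (B : set R) : measurable B ->
    lebesgue_measure.-integrable B (EFin \o beta_kernel m (1 - m)).
  by move=> mB; exact: integrable_beta_kernel.
have iKn (B : set R) : measurable B -> lebesgue_measure.-integrable B
    (EFin \o beta_kernel (n.+1%:R * m) (n.+1%:R * (1 - m))).
  by move=> mB; apply: integrable_beta_kernel => //; rewrite mulr_gt0.
have iKZ c (B : set R) : measurable B -> lebesgue_measure.-integrable B
    (EFin \o (fun t => c * beta_kernel m (1 - m) t)).
  move=> mB; rewrite (_ : _ \o _ = fun t => (c%:E * (beta_kernel m (1 - m) t)%:E)%E)//.
  by apply: integrableZl => //; exact: iK.
have hA : beta_mass (n.+1%:R * m) (n.+1%:R * (1 - m)) A <=
    p ^+ n * beta_mass m (1 - m) A.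
  rewrite /beta_mass -RintegralZl//; last exact: iK.
  apply: le_Rintegral => //; [exact: iKn|exact: iKZ|].
  move=> t At; have [t01|t01] := boolP (0 < t < 1); last first.
    by rewrite !beta_kernel0// mulr0.
  rewrite beta_kernel_mpS// ler_wpM2r ?beta_kernel_ge0//.
  by rewrite lerXn2r ?nnegrE ?mulr_ge0 ?powR_ge0//; exact: hp.
have hB : q ^+ n * beta_mass m (1 - m) `[u, v] <=
    beta_mass (n.+1%:R * m) (n.+1%:R * (1 - m)) `[0, 1].
  apply: (@le_trans _ _ (beta_mass (n.+1%:R * m) (n.+1%:R * (1 - m)) `[u, v])).
    rewrite /beta_mass -RintegralZl//; last exact: iK.
    apply: le_Rintegral => //; [exact: iKZ|exact: iKn|].
    move=> t /=; rewrite in_itv/= => utv.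
    rewrite beta_kernel_mpS; last by lra.
    rewrite ler_wpM2r ?beta_kernel_ge0//.
    by rewrite lerXn2r ?nnegrE ?(ltW q0) ?mulr_ge0 ?powR_ge0//; exact: hq.
  apply: le_beta_mass => //; rewrite ?mulr_gt0//.
  by apply: subset_itv; rewrite bnd_simp ltW.
have B0 : 0 < beta_mass m (1 - m) `[u, v] by exact: beta_mass_itv_gt0.
have -> : C * (p / q) ^+ n =
    (p ^+ n * beta_mass m (1 - m) A) / (q ^+ n * beta_mass m (1 - m) `[u, v]).
  by rewrite /C expr_div_n; field; rewrite gt_eqF//= expf_neq0// gt_eqF.
apply: ler_pM; rewrite ?invr_ge0 ?beta_mass_ge0//.
rewrite lef_pV2 ?posrE//; last by rewrite mulr_gt0// exprn_gt0.
by rewrite beta_mass01_gt0// mulr_gt0.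
Unshelve. all: by end_near. Qed.

Lemma beta_cdf_mp_lt (R : realType) (m x : R) : 0 < m < 1 -> x < m ->
  beta_cdf_mp m n.+1%:R x @[n --> \oo] --> (0 : R).
Proof.
move=> m01 xm; have [m0 m1] := andP m01; have n0 : 0 < 1 - m by rewrite subr_gt0.
have [x0|x0] := leP x 0.
  rewrite (_ : (fun n : nat => beta_cdf_mp m n.+1%:R x) = cst 0); first exact: cvg_cst.
  by apply/funext => n; rewrite /beta_cdf_mp beta_cdf_le0// mulr_gt0.
rewrite (_ : (fun n : nat => beta_cdf_mp m n.+1%:R x) = (fun n =>
  beta_mass (n.+1%:R * m) (n.+1%:R * (1 - m)) `]-oo, x] /
  beta_mass (n.+1%:R * m) (n.+1%:R * (1 - m)) `[0, 1])); last first.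
  by apply/funext => n; rewrite /beta_cdf_mp beta_cdfE// mulr_gt0.
(* on [[u, v]], strictly between [x] and [m], the weight exceeds that at [x] *)
pose u := (x + m) / 2; pose v := (u + m) / 2.
have xu : x < u by rewrite /u; lra.
have uv : u < v by rewrite /v /u; lra.
have vm : v < m by rewrite /v /u; lra.
apply: (@beta_mass_concentrate _ _ (x `^ m * (1 - x) `^ (1 - m))
  (u `^ m * (1 - u) `^ (1 - m)) u v) => //; rewrite ?mulr_ge0 ?powR_ge0//.
- by lra.
- by lra.
- by apply: beta_mode_lt => //; lra.
- by move=> t /=; rewrite in_itv/= => tx t01; apply: beta_mode_le => //; lra.
- by move=> t utv; apply: beta_mode_le => //; lra.
Qed.

Lemma beta_cdf_mp_gt (R : realType) (m x : R) : 0 < m < 1 -> m < x ->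
  beta_cdf_mp m n.+1%:R x @[n --> \oo] --> (1 : R).
Proof.
move=> m01 xm; have [m0 m1] := andP m01; have n0 : 0 < 1 - m by rewrite subr_gt0.
have [x1|x1] := leP 1 x.
  rewrite (_ : (fun n : nat => beta_cdf_mp m n.+1%:R x) = cst 1); first exact: cvg_cst.
  by apply/funext => n; rewrite /beta_cdf_mp beta_cdf_ge1// mulr_gt0.
rewrite (_ : (fun n : nat => beta_cdf_mp m n.+1%:R x) = (fun n => 1 -
  beta_mass (n.+1%:R * m) (n.+1%:R * (1 - m)) `]x, 1] /
  beta_mass (n.+1%:R * m) (n.+1%:R * (1 - m)) `[0, 1])); last first.
  apply/funext => n; rewrite -beta_cdfB ?mulr_gt0// ?(ltW x1)//.
  by rewrite (@beta_cdf_ge1 _ _ _ 1) ?mulr_gt0// subKr.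
rewrite -[X in _ --> X](subr0 1); apply: cvgB; first exact: cvg_cst.
(* on [[u, v]], strictly between [m] and [x], the weight exceeds that at [x] *)
pose v := (x + m) / 2; pose u := (v + m) / 2.
have vx : v < x by rewrite /v; lra.
have uv : u < v by rewrite /u /v; lra.
have mu : m < u by rewrite /u /v; lra.
apply: (@beta_mass_concentrate _ _ (x `^ m * (1 - x) `^ (1 - m))
  (v `^ m * (1 - v) `^ (1 - m)) u v) => //; rewrite ?mulr_ge0 ?powR_ge0//.
- by lra.
- by lra.
- by apply: beta_mode_lt => //; lra.
- by move=> t /=; rewrite in_itv/= => tx t01; apply: beta_mode_le => //; lra.
- by move=> t utv; apply: beta_mode_le => //; lra.
Qed.

(** * Variance of bounded functions *)

(** Real-valued, as required by the intermediate value theorem. *)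
Definition rvariance d (T : measurableType d) (R : realType)
    (P : probability T R) (f : T -> R) : R :=
  \int[P]_t (f t ^+ 2) - (\int[P]_t f t) ^+ 2.

Lemma integrable_bounded_prob d (T : measurableType d) (R : realType)
    (P : probability T R) (f : T -> R) (c : R) :
  measurable_fun setT f -> (forall t, `|f t| <= c) ->
  P.-integrable setT (EFin \o f).
Proof.
move=> mf fc; apply: measurable_bounded_integrable => //.
  by rewrite (@le_lt_trans _ _ 1%E) ?ltry// probability_le1.
exists c; split; first exact: num_real.
by move=> y cy t _; apply: le_trans (ltW cy).
Qed.

Lemma normr_sqr_le1 (R : realType) (x : R) : `|x| <= 1 -> `|x ^+ 2| <= 1.
Proof. by move=> x1; rewrite normrX expr_le1. Qed.

Lemma integrable_sqr_bounded_prob d (T : measurableType d) (R : realType)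
    (P : probability T R) (f : T -> R) :
  measurable_fun setT f -> (forall t, `|f t| <= 1) ->
  P.-integrable setT (EFin \o (fun t => f t ^+ 2)).
Proof.
move=> mf f1; apply: (@integrable_bounded_prob _ _ _ _ _ 1).
  exact: measurable_funX.
by move=> t; exact: normr_sqr_le1.
Qed.

Lemma variance_rvariance d (T : measurableType d) (R : realType)
    (P : probability T R) (f : T -> R) :
  measurable_fun setT f -> (forall t, `|f t| <= 1) ->
  'V_P[f] = (rvariance P f)%:E.
Proof.
move=> mf f1; have i1 := integrable_bounded_prob P mf f1.
have i2 := integrable_sqr_bounded_prob P mf f1.
rewrite /variance covarianceE; try exact/Lfun1_integrable.
rewrite !unlock /rvariance EFinB expr2 EFinM.
by rewrite !fineK//; exact: integrable_fin_num.
Qed.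

Lemma Rintegral_cst_prob d (T : measurableType d) (R : realType)
    (P : probability T R) (c : R) : \int[P]_t c = c.
Proof.
rewrite Rintegral_cst//.
have -> : fine (P setT) = 1 by rewrite probability_setT.
by rewrite mulr1.
Qed.

Lemma rvariance_subr d (T : measurableType d) (R : realType)
    (P : probability T R) (f : T -> R) (c : R) :
  measurable_fun setT f -> (forall t, `|f t| <= 1) ->
  rvariance P (fun t => f t - c) = rvariance P f.
Proof.
move=> mf f1; have i1 := integrable_bounded_prob P mf f1.
have i2 := integrable_sqr_bounded_prob P mf f1.
have ic (r : R) : P.-integrable setT (EFin \o (fun=> r)).
  exact: finite_measure_integrable_cst.
have iZ (r : R) : P.-integrable setT (EFin \o (fun t => r * f t)).
  rewrite (_ : _ \o _ = fun t => (r%:E * (f t)%:E)%E)//.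
  exact: integrableZl.
have iB : P.-integrable setT (EFin \o (fun t => f t ^+ 2 - (2 * c) * f t)).
  rewrite (_ : _ \o _ = ((EFin \o (fun t => f t ^+ 2)%R) \-
    (EFin \o (fun t => (2 * c) * f t)%R))%E)//.
  exact: integrableB.
rewrite /rvariance RintegralB// Rintegral_cst_prob.
rewrite (_ : (fun t => (f t - c) ^+ 2) =
    (fun t => (f t ^+ 2 - (2 * c) * f t) + c ^+ 2)); last first.
  by apply/funext => t; ring.
rewrite RintegralD// RintegralB// RintegralZl// Rintegral_cst_prob.
ring.
Qed.

Lemma cvg_Rintegral_bounded d (T : measurableType d) (R : realType)
    (P : probability T R) (f_ : nat -> T -> R) (f : T -> R) :
  (forall n, measurable_fun setT (f_ n)) -> measurable_fun setT f ->
  (forall n t, `|f_ n t| <= 1) ->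
  {ae P, forall t, f_ n t @[n --> \oo] --> f t} ->
  \int[P]_t f_ n t @[n --> \oo] --> \int[P]_t f t.
Proof.
move=> mf_ mf f1 cf.
have [|||||ifoo _ h] := @dominated_convergence _ _ _ P setT measurableT
    (fun n t => (f_ n t)%:E) (EFin \o f) (cst 1%E).
- by move=> n; exact/measurable_EFinP.
- exact/measurable_EFinP.
- by apply: filterS cf => t /= ct _; apply: cvg_EFin; [exact: nearW|exact: ct].
- exact: finite_measure_integrable_cst.
- by apply: aeW => t n _; rewrite lee_fin.
by apply: fine_cvg; rewrite fineK//; exact: integrable_fin_num.
Qed.

Lemma cvg_rvariance d (T : measurableType d) (R : realType)
    (P : probability T R) (f_ : nat -> T -> R) (f : T -> R) :
  (forall n, measurable_fun setT (f_ n)) -> measurable_fun setT f ->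
  (forall n t, `|f_ n t| <= 1) ->
  {ae P, forall t, f_ n t @[n --> \oo] --> f t} ->
  rvariance P (f_ n) @[n --> \oo] --> rvariance P f.
Proof.
move=> mf_ mf f1 cf; apply: cvgB.
  apply: (@cvg_Rintegral_bounded _ _ _ _ (fun n t => f_ n t ^+ 2)).
  - by move=> n; exact: measurable_funX.
  - exact: measurable_funX.
  - by move=> n t; exact: normr_sqr_le1.
  - by apply: filterS cf => t ct; rewrite expr2; apply: cvgM.
have h := cvg_Rintegral_bounded mf_ mf f1 cf.
by rewrite expr2; apply: cvgM.
Qed.

(** * Every variance below 1/4 is reached along the ray *)

Lemma beta_cdf_mp_itv01 (R : realType) (m s x : R) : 0 < m < 1 -> 0 < s ->
  0 <= beta_cdf_mp m s x <= 1.
Proof.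
by move=> /andP[m0 m1] s0; rewrite beta_cdf_itv01 ?mulr_gt0 ?subr_gt0.
Qed.

Lemma normr_beta_cdf_mp (R : realType) (m s x : R) : 0 < m < 1 -> 0 < s ->
  `|beta_cdf_mp m s x| <= 1.
Proof.
by move=> m01 s0; have /andP[h0 h1] := beta_cdf_mp_itv01 x m01 s0; rewrite ger0_norm.
Qed.

Lemma measurable_beta_cdf_mp d (T : measurableType d) (R : realType) (m s : R)
    (X : T -> R) : 0 < m < 1 -> 0 < s -> measurable_fun setT X ->
  measurable_fun setT (fun t => beta_cdf_mp m s (X t)).
Proof.
move=> /andP[m0 m1] s0 mX.
apply: (@measurableT_comp _ _ _ _ _ _ (beta_cdf_mp m s)) => //.
apply: continuous_measurable_fun.
by apply: continuous_beta_cdf; rewrite mulr_gt0 ?subr_gt0.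
Qed.

Lemma continuous_rvariance_beta d (T : measurableType d) (R : realType)
    (P : probability T R) (X : T -> R) (m : R) :
  0 < m < 1 -> measurable_fun setT X ->
  {in `]0, +oo[, continuous (fun s => rvariance P (fun t => beta_cdf_mp m s (X t)))}.
Proof.
move=> m01 mX s; rewrite in_itv/= andbT => s0.
have sI : s \in (`](s / 2)%R, (s + 1)%R[%classic : set R).
  by rewrite inE/= in_itv/=; lra.
have I0 r : (`](s / 2)%R, (s + 1)%R[%classic : set R) r -> 0 < r.
  by rewrite /= in_itv/= => /andP[h _]; lra.
have mB r : 0 < r -> measurable_fun setT (fun t => beta_cdf_mp m r (X t)).
  by move=> r0; exact: measurable_beta_cdf_mp.
have cB t : {in (`](s / 2)%R, (s + 1)%R[%classic : set R),
    continuous (fun r => beta_cdf_mp m r (X t))}.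
  by move=> r /set_mem/I0 r0; apply: continuous_beta_cdf_mp; rewrite ?in_itv/= ?andbT.
apply: cvgB.
  apply: (@continuity_under_integral R _ _ P (fun r t => beta_cdf_mp m r (X t) ^+ 2)
    setT measurableT (s / 2) (s + 1) _ _ (cst 1)) => //.
  - move=> r /I0 r0; apply: integrable_sqr_bounded_prob; first exact: mB.
    by move=> t; exact: normr_beta_cdf_mp.
  - apply: aeW => t _ r /(cB t) c; rewrite /continuous_at.
    by under eq_cvg do rewrite expr2; rewrite expr2; exact: cvgM.
  - exact: finite_measure_integrable_cst.
  - move=> r /I0 r0; apply: aeW => t _; apply: normr_sqr_le1.
    exact: normr_beta_cdf_mp.
have c1 : {for s, continuous (fun r => \int[P]_t beta_cdf_mp m r (X t))}.
  apply: (@continuity_under_integral R _ _ P (fun r t => beta_cdf_mp m r (X t))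
    setT measurableT (s / 2) (s + 1) _ _ (cst 1)) => //.
  - move=> r /I0 r0; apply: (@integrable_bounded_prob _ _ _ _ _ 1); first exact: mB.
    by move=> t; exact: normr_beta_cdf_mp.
  - by apply: aeW => t _ r /(cB t).
  - exact: finite_measure_integrable_cst.
  - move=> r /I0 r0; apply: aeW => t _; exact: normr_beta_cdf_mp.
by under eq_cvg do rewrite expr2; rewrite expr2; exact: cvgM.
Qed.

(** Subtracting the constant [B_s m] does not change the variance and turns the
    flattening of [B_s] into convergence to 0. *)
Lemma cvg_rvariance_beta_flat d (T : measurableType d) (R : realType)
    (P : probability T R) (X : T -> R) (m : R) :
  0 < m < 1 -> measurable_fun setT X -> {ae P, forall t, 0 < X t < 1} ->
  rvariance P (fun t => beta_cdf_mp m n.+1%:R^-1 (X t)) @[n --> \oo] --> (0 : R).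
Proof.
move=> m01 mX X01.
have s0 n : 0 < n.+1%:R^-1 :> R by rewrite invr_gt0.
have h : rvariance P (fun t => beta_cdf_mp m n.+1%:R^-1 (X t) -
    beta_cdf_mp m n.+1%:R^-1 m) @[n --> \oo] --> rvariance P (cst 0).
  apply: cvg_rvariance => //.
  - by move=> n; apply: measurable_funB => //; exact: measurable_beta_cdf_mp.
  - move=> n t; have := @beta_cdf_mp_itv01 R m _ (X t) m01 (s0 n).
    have := @beta_cdf_mp_itv01 R m _ m m01 (s0 n).
    by move=> /andP[? ?] /andP[? ?]; rewrite ler_norml; lra.
  - apply: filterS X01 => t /andP[x0 x1]; have [m0 m1] := andP m01.
    have [mx|/ltW xm] := leP m (X t); first exact: beta_cdf_mp_flat.
    have := @beta_cdf_mp_flat _ _ _ _ m01 x0 xm m1.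
    move/cvgN; rewrite oppr0; apply: cvg_trans; apply: near_eq_cvg.
    by apply: nearW => n /=; rewrite fctE opprB.
have E0 : rvariance P (cst 0) = 0.
  by rewrite /rvariance /= !Rintegral_cst_prob expr0n subrr.
rewrite E0 in h; apply: cvg_trans h; apply: near_eq_cvg; apply: nearW => n.
rewrite rvariance_subr//; first exact: measurable_beta_cdf_mp.
by move=> t; exact: normr_beta_cdf_mp.
Qed.

(** The limit is the variance of the indicator of an event of probability 1/2. *)
Lemma cvg_rvariance_beta_step d (T : measurableType d) (R : realType)
    (P : probability T R) (X : T -> R) (m : R) :
  0 < m < 1 -> measurable_fun setT X ->
  P [set t | X t = m] = 0%E -> P [set t | m < X t] = (2^-1)%:E ->
  rvariance P (fun t => beta_cdf_mp m n.+1%:R (X t)) @[n --> \oo] --> (4^-1 : R).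
Proof.
move=> m01 mX Pm Phalf; pose A := [set t | m < X t].
have mA : measurable A.
  rewrite (_ : A = X @^-1` `]m, +oo[); last first.
    by apply/seteqP; split=> t; rewrite /A /= in_itv/= andbT.
  by rewrite -[X in measurable X]setTI; exact: mX.
have mE : measurable [set t | X t = m].
  by rewrite -[X in measurable X]setTI; apply: (mX measurableT [set m]).
have -> : 4^-1 = rvariance P (\1_A : T -> R).
  have iA : \int[P]_t (\1_A t : R) = 2^-1.
    have -> : 2^-1 = fine (P A) by rewrite [P A]Phalf.
    by rewrite /Rintegral integral_indic// setIT.
  rewrite /rvariance iA (_ : (fun t => _ ^+ 2) = (\1_A : T -> R)).
    by rewrite iA; field.
  by apply/funext => t; rewrite indicE; case: (_ \in _); rewrite ?expr1n// expr0n.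
apply: cvg_rvariance => //.
- by move=> n; exact: measurable_beta_cdf_mp.
- by move=> n t; exact: normr_beta_cdf_mp.
exists [set t | X t = m]; split => // t /= h.
have [xm|xm|//] := ltgtP (X t) m; exfalso; apply: h.
- rewrite indicE memNset; last by rewrite /A /=; apply/negP; rewrite -leNgt ltW.
  exact: beta_cdf_mp_lt.
- by rewrite indicE mem_set//; exact: beta_cdf_mp_gt.
Qed.

(** The intermediate value theorem along the ray of beta laws of mean [m]. The
    hypotheses on [X] say that it lies in [ ]0, 1[ ] almost surely and that it
    is above or below its median [m] with probability 1/2 each. *)
Lemma exists_beta_variance d (T : measurableType d) (R : realType)
    (P : probability T R) (X : T -> R) (m v : R) :
  0 < m < 1 -> 0 < v < 4^-1 -> measurable_fun setT X ->
  {ae P, forall t, 0 < X t < 1} ->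
  P [set t | X t = m] = 0%E -> P [set t | m < X t] = (2^-1)%:E ->
  exists2 s, 0 < s & rvariance P (fun t => beta_cdf_mp m s (X t)) = v.
Proof.
move=> m01 /andP[v0 v4] mX X01 Pm Phalf.
pose V := fun s : R => rvariance P (fun t => beta_cdf_mp m s (X t)).
suff [s s0 Vs] : exists2 s, 0 < s & V s = v by exists s.
have [a a0 [a1 Va]] : exists2 a : R, 0 < a & a <= 1 /\ V a < v.
  have := cvg_rvariance_beta_flat m01 mX X01.
  move=> /cvgr_lt /(_ _ v0)[n _ /(_ n (leqnn _)) h].
  exists n.+1%:R^-1; first by rewrite invr_gt0.
  by split; [rewrite invf_le1// ler1n|exact: h].
have [b b1 Vb] : exists2 b : R, 1 <= b & v < V b.
  have := cvg_rvariance_beta_step m01 mX Pm Phalf.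
  move=> /cvgr_gt /(_ _ v4)[n _ /(_ n (leqnn _)) h].
  by exists n.+1%:R; [rewrite ler1n|exact: h].
have cV : {in `]0, +oo[, continuous V} by exact: continuous_rvariance_beta.
clearbody V.
have [||c] := @IVT R V a b v (le_trans a1 b1).
- apply: continuous_in_subspaceT => s /set_mem/=; rewrite in_itv/= => /andP[h _].
  by apply: cV; rewrite in_itv/= andbT (lt_le_trans a0).
- by rewrite ge_min le_max (ltW Va) (ltW Vb) orbT.
rewrite in_itv/= => /andP[ac _] Vc; exists c; last exact: Vc.
exact: lt_le_trans ac.
Qed.

(** * The law of a continuous distribution function *)

(** Packages a function whose properties are only known propositionally as a
    member of the structure [cumulativeBounded]. *)
Lemma exists_cumulativeBounded (R : realType) (G : R -> R) :
  {homo G : x y / x <= y} -> continuous G ->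
  G x @[x --> -oo] --> (0 : R) -> G x @[x --> +oo] --> (1 : R) ->
  exists c : cumulativeBounded (0 : R) (1 : R), G = c :> (R -> R).
Proof.
move=> Gnd Gc G0 G1.
have rc : right_continuous G by exact: right_continuousW.
pose m1 := isCumulative.Build R _ R G Gnd rc.
pose m2 := isCumulativeBounded.Build R 0 1 G G0 G1.
pose c : cumulativeBounded (0 : R) (1 : R) := HB.pack G m1 m2.
by exists c.
Qed.

Lemma stieltjes_itvNyc (R : realType) (c : cumulativeBounded (0 : R) (1 : R)) (x : R) :
  lebesgue_stieltjes_measure c `]-oo, x] = (c x)%:E.
Proof.
have := cdf_lebesgue_stieltjes_id c x.
by rewrite /cdf /distribution /pushforward preimage_id.
Qed.

Lemma stieltjes_itvoy (R : realType) (c : cumulativeBounded (0 : R) (1 : R)) (x : R) :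
  lebesgue_stieltjes_measure c `]x, +oo[ = (1 - c x)%:E.
Proof.
rewrite -setCitvl.
rewrite (@probability_setC _ _ _ (lebesgue_stieltjes_measure c)).
  by rewrite EFinB; congr (1 - _)%E; exact: stieltjes_itvNyc.
exact: measurable_itv.
Qed.

Lemma stieltjes_itvoc (R : realType) (c : cumulativeBounded (0 : R) (1 : R)) (x y : R) :
  x <= y -> lebesgue_stieltjes_measure c `]x, y] = (c y - c x)%:E.
Proof.
move=> xy; rewrite /lebesgue_stieltjes_measure /measure_extension/=.
by rewrite measurable_mu_extE/= ?wlength_itv_bnd//; exact: is_ocitv.
Qed.

Lemma cumulativeBounded_itv01 (R : realType) (c : cumulativeBounded (0 : R) (1 : R))
  (x : R) : 0 <= c x <= 1.
Proof.
by rewrite -!lee_fin -stieltjes_itvNyc measure_ge0 probability_le1.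
Qed.

Lemma cumulativeBounded_surj (R : realType) (c : cumulativeBounded (0 : R) (1 : R))
  (p : R) : continuous c -> 0 < p < 1 -> exists x, c x = p.
Proof.
move=> cc /andP[p0 p1].
have [a ca] : exists a, c a < p.
  have [a [_ h]] := cvgr_lt _ (cumulativeNy c) _ p0.
  by exists (a - 1); apply: h; rewrite ltrBlDr ltrDl.
have [b cb] : exists b, p < c b.
  have [b [_ h]] := cvgr_gt _ (cumulativey c) _ p1.
  by exists (b + 1); apply: h; rewrite ltrDl.
have ab : a <= b.
  rewrite leNgt; apply/negP => /ltW /(cumulative_is_nondecreasing c).
  by rewrite leNgt (lt_trans ca cb).
have [||x _ cx] := @IVT R c a b p ab; last by exists x.
  by apply: continuous_subspaceT.
by rewrite ge_min le_max (ltW ca) (ltW cb) orbT.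
Qed.

Lemma cumulativeBounded_nondecreasing (R : realType)
    (c : cumulativeBounded (0 : R) (1 : R)) :
  {homo c : x y / x <= y}.
Proof. exact: (cumulative_is_nondecreasing c). Qed.

Lemma le_stieltjes (R : realType) (c : cumulativeBounded (0 : R) (1 : R)) (A B : set R) :
  measurable A -> measurable B -> A `<=` B ->
  (lebesgue_stieltjes_measure c A <= lebesgue_stieltjes_measure c B)%E.
Proof.
move=> mA mB AB.
by apply: (@le_measure _ _ _ (lebesgue_stieltjes_measure c)) => //; rewrite inE.
Qed.

Lemma stieltjes_null (R : realType) (c : cumulativeBounded (0 : R) (1 : R)) (A : set R) :
  measurable A ->
  (forall e : R, 0 < e -> exists2 B : set R, measurable B /\ A `<=` B &
    (lebesgue_stieltjes_measure c B <= e%:E)%E) ->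
  lebesgue_stieltjes_measure c A = 0%E.
Proof.
move=> mA h; apply/eqP; rewrite eq_le measure_ge0 andbT.
apply/lee_addgt0Pr => e e0; rewrite add0e.
have [B [mB AB] Be] := h _ e0.
by apply: le_trans Be; exact: le_stieltjes.
Qed.

Lemma measurable_cumulative_le (R : realType)
    (c : cumulativeBounded (0 : R) (1 : R)) (p : R) :
  continuous c -> measurable [set x | c x <= p].
Proof.
move=> cc; rewrite (_ : [set x | c x <= p] = c @^-1` `]-oo, p]).
  rewrite -[X in measurable X]setTI.
  by apply: (continuous_measurable_fun cc) => //; exact: measurable_itv.
by apply/seteqP; split=> x; rewrite /= in_itv.
Qed.

Lemma measurable_cumulative_ge (R : realType)
    (c : cumulativeBounded (0 : R) (1 : R)) (p : R) :
  continuous c -> measurable [set x | p <= c x].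
Proof.
move=> cc; rewrite (_ : [set x | p <= c x] = c @^-1` `[p, +oo[).
  rewrite -[X in measurable X]setTI.
  by apply: (continuous_measurable_fun cc) => //; exact: measurable_itv.
by apply/seteqP; split=> x; rewrite /= in_itv/= ?andbT.
Qed.

Lemma stieltjes_set1 (R : realType) (c : cumulativeBounded (0 : R) (1 : R)) (x : R) :
  continuous c -> lebesgue_stieltjes_measure c [set x] = 0%E.
Proof.
move=> cc; apply: stieltjes_null => [|e e0]; first exact: measurable_set1.
have h : c y @[y --> x^'-] --> c x by apply: cvg_at_left_filter; exact: cc.
have lt : c x - e < c x by rewrite ltrBlDr ltrDl.
have [y [yx cy]] : exists y, y < x /\ c x - e < c y.
  near (x^'-)%R => y; exists y; split; first by near: y; exact: nbhs_left_lt.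
  by near: y; exact: cvgr_gt h _ lt.
exists `]y, x]%classic; first split.
- exact: measurable_itv.
- by move=> _ ->; rewrite /= in_itv/= yx lexx.
- by rewrite stieltjes_itvoc ?(ltW yx)// lee_fin lerBlDr -lerBlDl ltW.
Unshelve. all: by end_near. Qed.

(** The set lies below any point where [c] takes a small positive value [p], and
    the law gives mass [p] to that half-line. This avoids discussing the
    supremum of the set, which need not exist. *)
Lemma stieltjes_le0 (R : realType) (c : cumulativeBounded (0 : R) (1 : R)) :
  continuous c -> lebesgue_stieltjes_measure c [set x | c x <= 0] = 0%E.
Proof.
move=> cc; apply: stieltjes_null => [|e e0]; first exact: measurable_cumulative_le.
have [x cx] : exists x, c x = Num.min e (2^-1).
  apply: cumulativeBounded_surj => //; rewrite lt_min gt_min e0 orbC invf_lt1// ltr1n//.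
  by rewrite invr_gt0 ltr0n.
exists `]-oo, x]%classic; first split.
- exact: measurable_itv.
- move=> y /= cy; rewrite in_itv/= leNgt; apply/negP.
  move=> /ltW /(cumulativeBounded_nondecreasing c).
  by rewrite leNgt cx (le_lt_trans cy)// lt_min e0 invr_gt0 ltr0n.
- by rewrite stieltjes_itvNyc lee_fin cx ge_min lexx.
Qed.

Lemma stieltjes_ge1 (R : realType) (c : cumulativeBounded (0 : R) (1 : R)) :
  continuous c -> lebesgue_stieltjes_measure c [set x | 1 <= c x] = 0%E.
Proof.
move=> cc; apply: stieltjes_null => [|e e0]; first exact: measurable_cumulative_ge.
have m0 : 0 < Num.min e (2^-1) by rewrite lt_min e0 invr_gt0 ltr0n.
have m1 : Num.min e (2^-1) < 1 by rewrite gt_min orbC invf_lt1// ltr1n.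
have [x cx] : exists x, c x = 1 - Num.min e (2^-1).
  by apply: cumulativeBounded_surj => //; rewrite subr_gt0 m1/= ltrBlDr ltrDl.
exists `]x, +oo[%classic; first split.
- exact: measurable_itv.
- move=> y /= cy; rewrite in_itv/= andbT ltNge; apply/negP.
  move=> /(cumulativeBounded_nondecreasing c).
  by rewrite leNgt cx (lt_le_trans _ cy)// ltrBlDr ltrDl.
- by rewrite stieltjes_itvoy lee_fin cx opprB addrC subrK ge_min lexx.
Qed.

Lemma ae_cumulative_itv01 (R : realType) (c : cumulativeBounded (0 : R) (1 : R)) :
  continuous c -> {ae lebesgue_stieltjes_measure c, forall x, 0 < c x < 1}.
Proof.
move=> cc; exists ([set x | c x <= 0] `|` [set x | 1 <= c x]); split.
- apply: measurableU; [exact: measurable_cumulative_le|exact: measurable_cumulative_ge].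
- have m1 := @measurable_cumulative_le R c 0 cc.
  have m2 := @measurable_cumulative_ge R c 1 cc.
  rewrite (@null_set_setU _ _ _ (lebesgue_stieltjes_measure c))//.
  + exact: stieltjes_le0.
  + exact: stieltjes_ge1.
- move=> x /= h; have [c0|c0] := leP (c x) 0; first by left.
  by right; rewrite leNgt; apply/negP => c1; apply: h; rewrite c0 c1.
Qed.

(** The Lebesgue-Stieltjes measure lives on [measurableTypeR R], which has the
    same carrier and the same measurable sets as [R] but another display; the
    lemma moves a random variable from one to the other. *)
Lemma exists_mfun_measurableTypeR d (T : measurableType d) (R : realType)
    (Y : {mfun T >-> R}) :
  exists Y' : {mfun T >-> measurableTypeR R}, Y' = Y :> (T -> R).
Proof.
have mY : measurable_fun setT (Y : T -> measurableTypeR R).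
  exact: (@measurable_funPT _ _ _ _ Y).
pose mix := isMeasurableFun.Build _ _ T (measurableTypeR R) Y mY.
pose Y' : {mfun T >-> measurableTypeR R} := HB.pack (Y : T -> measurableTypeR R) mix.
by exists Y'.
Qed.

Lemma distribution_stieltjes d (T : measurableType d) (R : realType)
    (P : probability T R) (Y : {RV P >-> R}) (c : cumulativeBounded (0 : R) (1 : R)) :
  has_cdf Y c -> forall A : set R, measurable A ->
  lebesgue_stieltjes_measure c A = P (Y @^-1` A).
Proof.
move=> Yc A mA; have [Y' Y'E] := exists_mfun_measurableTypeR Y; rewrite -Y'E.
have cdfE x : P (Y @^-1` `]-oo, x]) = (c x)%:E by exact: Yc.
rewrite (@lebesgue_stieltjes_measure_unique R c (distribution P Y'))//.
move=> _ [[a b] _ <-] /=.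
have [ab|ba] := leP a b; last first.
  by rewrite set_itv_ge ?measure0// bnd_simp -leNgt ltW.
rewrite stieltjes_itvoc// /distribution /pushforward Y'E.
have -> : Y @^-1` `]a, b] = (Y @^-1` `]-oo, b]) `\` (Y @^-1` `]-oo, a]).
  apply/seteqP; split=> t; rewrite /= !in_itv/=.
    by move=> /andP[ay yb]; split=> //; apply/negP; rewrite -ltNge.
  by move=> [-> /negP]; rewrite -ltNge => ->.
have mYi x : measurable (Y @^-1` `]-oo, x]) by exact: measurable_funPTI.
rewrite measureD//; last by rewrite (le_lt_trans (probability_le1 _ _))// ltry.
rewrite setIidr; first by rewrite EFinB -!cdfE.
by move=> t; rewrite /= !in_itv/= => /le_trans; apply.
Qed.

Lemma rvariance_distribution d (T : measurableType d) (R : realType)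
    (P : probability T R) (Y : {RV P >-> R}) (c : cumulativeBounded (0 : R) (1 : R))
    (h : R -> R) :
  has_cdf Y c -> measurable_fun setT h -> (forall y, 0 <= h y) ->
  rvariance P (h \o Y) = rvariance (lebesgue_stieltjes_measure c) h.
Proof.
move=> Yc mh h0; have [Y' Y'E] := exists_mfun_measurableTypeR Y.
have E (g : R -> R) : measurable_fun setT g -> (forall y, 0 <= g y) ->
    \int[P]_t g (Y t) = \int[lebesgue_stieltjes_measure c]_y g y.
  move=> mg g0; rewrite /Rintegral; congr fine.
  rewrite (@eq_measure_integral _ _ _ _ (distribution P Y')); last first.
    move=> A mA _; have := distribution_stieltjes Yc mA.
    by rewrite -Y'E; apply.
  rewrite (@ge0_integral_distribution _ _ _ _ _ P Y' (EFin \o g)) ?Y'E//.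
  exact/measurable_EFinP.
have E2 := E (fun y => h y ^+ 2) (measurable_funX _ mh) (fun y => sqr_ge0 _).
by rewrite /rvariance -(E h mh h0) -E2.
Qed.

(** * The class of distribution functions carried by an interval *)

Lemma cdf_class_plus_intro (R : realType) (I : set R)
    (c : cumulativeBounded (0 : R) (1 : R)) :
  is_interval I -> continuous c ->
  {in I &, {homo c : x y / x < y}} -> (forall x, 0 < c x < 1 -> I x) ->
  cdf_class_plus I c.
Proof.
move=> hI cc cI h; exists c; split => //.
have mI := is_interval_measurable hI.
have : (lebesgue_stieltjes_measure c (~` I) = 0)%E.
  have [N [mN N0 sub]] := ae_cumulative_itv01 cc.
  apply/eqP; rewrite eq_le measure_ge0 andbT -N0; apply: le_stieltjes => //.
    exact: measurableC.
  by move=> x nIx; apply: sub => /= /h.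
rewrite (@probability_setC _ _ _ (lebesgue_stieltjes_measure c))// => /eqP.
rewrite sube_eq//; first by rewrite add0e => /eqP <-.
Qed.

(** A point outside the interval [I] has all of [I] on one side, hence all the
    mass of every law in the class on that side. The value does not depend on
    the member of the class; this is what survives averaging. *)
Lemma cdf_class_plus_outside (R : realType) (I : set R) (x : R) :
  is_interval I -> ~ I x ->
  (forall F, cdf_class_plus I F -> F x = 0) \/
  (forall F, cdf_class_plus I F -> F x = 1).
Proof.
move=> hI nIx; have mI := is_interval_measurable hI.
have [[y [Iy yx]]|ny] := pselect (exists y, I y /\ y < x).
- right=> F [c [-> cI1 cc _]].
  have : (lebesgue_stieltjes_measure c I <= lebesgue_stieltjes_measure c `]-oo, x])%E.
    apply: le_stieltjes => //.
    move=> z Iz; rewrite /= in_itv/= leNgt; apply/negP => xz.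
    by apply: nIx; apply: (hI y z Iy Iz); rewrite (ltW yx) (ltW xz).
  rewrite cI1 stieltjes_itvNyc lee_fin => h.
  by apply/eqP; rewrite eq_le h andbT; have /andP[] := cumulativeBounded_itv01 c x.
- left=> F [c [-> cI1 cc _]].
  have : (lebesgue_stieltjes_measure c I <= lebesgue_stieltjes_measure c `]x, +oo[)%E.
    apply: le_stieltjes => //.
    move=> z Iz; rewrite /= in_itv/= andbT ltNge; apply/negP.
    rewrite le_eqVlt => /orP[/eqP zx|zx]; first by apply: nIx; rewrite -zx.
    by apply: ny; exists z.
  rewrite cI1 stieltjes_itvoy lee_fin => h.
  apply/eqP; rewrite eq_le; have /andP[-> _] := cumulativeBounded_itv01 c x.
  by rewrite andbT; lra.
Qed.

Lemma cdf_class_plus_mem (R : realType) (I : set R) (F : R -> R) (x : R) :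
  is_interval I -> cdf_class_plus I F -> 0 < F x < 1 -> I x.
Proof.
move=> hI CF F01; apply: contrapT => nIx.
by have [/(_ F CF)|/(_ F CF)] := cdf_class_plus_outside hI nIx => h;
  move: F01; rewrite h ltxx ?andbF.
Qed.

(** By continuity [F0] is still strictly between 0 and 1 at some [t] slightly to
    the left (right) of [y], so both [y] and [t] lie in [I], where [F] is
    strictly increasing. *)
Lemma cdf_class_plus_lt (R : realType) (I : set R) (F0 F : R -> R) (y z : R) :
  is_interval I -> cdf_class_plus I F0 -> cdf_class_plus I F -> 0 < F0 y < 1 ->
  (z < y -> F z < F y) /\ (y < z -> F y < F z).
Proof.
move=> hI CF0 CF y01; have Iy := cdf_class_plus_mem hI CF0 y01.
have [c0 [E0 _ cc0 _]] := CF0; have [c [E _ _ cI]] := CF.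
have [y0 y1] := andP y01; split=> zy.
  have h : F0 t @[t --> y^'-] --> F0 y by apply: cvg_at_left_filter; exact: cc0.
  have [t [zt ty t0]] : exists t, [/\ z < t, t < y & 0 < F0 t].
    near (y^'-)%R => t; exists t; split.
    - by near: t; exact: nbhs_left_gt.
    - by near: t; exact: nbhs_left_lt.
    - by near: t; exact: cvgr_gt h _ y0.
  have It : I t.
    apply: (cdf_class_plus_mem hI CF0); rewrite t0 (le_lt_trans _ y1)//.
    by rewrite E0; exact: cumulativeBounded_nondecreasing (ltW ty).
  apply: (@le_lt_trans _ _ (F t)); first rewrite E.
    exact: cumulativeBounded_nondecreasing (ltW zt).
  by apply: cI => //; rewrite inE.
have h : F0 t @[t --> y^'+] --> F0 y by apply: cvg_at_right_filter; exact: cc0.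
have [t [zt ty t0]] : exists t, [/\ t < z, y < t & F0 t < 1].
  near (y^'+)%R => t; exists t; split.
  - by near: t; exact: nbhs_right_lt.
  - by near: t; exact: nbhs_right_gt.
  - by near: t; exact: cvgr_lt h _ y1.
have It : I t.
  apply: (cdf_class_plus_mem hI CF0); rewrite t0 andbT (lt_le_trans y0)//.
  by rewrite E0; exact: cumulativeBounded_nondecreasing (ltW ty).
apply: (@lt_le_trans _ _ (F t)); last first.
  by rewrite E; exact: cumulativeBounded_nondecreasing (ltW zt).
by apply: cI => //; rewrite inE.
Unshelve. all: by end_near. Qed.

(** * Linear pools and their beta transforms *)

Definition linear_pool (R : realType) (k : nat) (w : 'I_k -> R)
    (Fs : 'I_k -> R -> R) (y : R) : R := \sum_(i < k) w i * Fs i y.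

Lemma linear_pool_lt (R : realType) (k : nat) (w : 'I_k -> R) (Fs : 'I_k -> R -> R)
    (x y : R) : (forall i, 0 <= w i) -> \sum_(i < k) w i = 1 ->
  (forall i, Fs i x < Fs i y) -> linear_pool w Fs x < linear_pool w Fs y.
Proof.
move=> w0 w1 xy; rewrite -subr_gt0 /linear_pool -sumrB.
have ge0 (i : 'I_k) : true -> 0 <= w i * Fs i y - w i * Fs i x.
  by move=> _; rewrite -mulrBr mulr_ge0// subr_ge0 ltW.
(* equality would force every weight to vanish *)
rewrite lt_neqAle sumr_ge0// andbT eq_sym; apply/eqP => /psumr_eq0P h.
suff : (1 : R) = 0 by apply/eqP; exact: oner_neq0.
rewrite -w1; apply: big1 => i _.
have /eqP := h ge0 i isT.
by rewrite -mulrBr mulf_eq0 subr_eq0 (gt_eqF (xy i)) orbF => /eqP.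
Qed.

Lemma linear_pool_cst (R : realType) (k : nat) (w : 'I_k -> R) (Fs : 'I_k -> R -> R)
    (y p : R) : \sum_(i < k) w i = 1 -> (forall i, Fs i y = p) ->
  linear_pool w Fs y = p.
Proof.
move=> w1 h; rewrite /linear_pool -[RHS]mul1r -w1 big_distrl/=.
by apply: eq_bigr => i _; rewrite h.
Qed.

Lemma cvg_linear_pool (R : realType) (k : nat) (w : 'I_k -> R) (Fs : 'I_k -> R -> R)
    (D : set_system R) (l : 'I_k -> R) : Filter D ->
  (forall i, Fs i x @[x --> D] --> l i) ->
  linear_pool w Fs x @[x --> D] --> \sum_(i < k) w i * l i.
Proof.
move=> FD h.
rewrite /linear_pool; elim: (index_enum _) => [|i r IHr].
  by under eq_cvg do rewrite big_nil; rewrite big_nil; exact: cvg_cst.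
under eq_cvg do rewrite big_cons; rewrite big_cons.
by apply: cvgD => //; apply: cvgM; [exact: cvg_cst|exact: h].
Qed.

Lemma linear_pool_cumulative (R : realType) (k : nat) (w : 'I_k -> R)
    (cs : 'I_k -> cumulativeBounded (0 : R) (1 : R)) :
  (forall i, 0 <= w i) -> \sum_(i < k) w i = 1 -> (forall i, continuous (cs i)) ->
  exists c : cumulativeBounded (0 : R) (1 : R),
    linear_pool w (fun i => cs i) = c /\ continuous c.
Proof.
move=> w0 w1 cc.
have Lc : continuous (linear_pool w (fun i => cs i)).
  by move=> x; apply: cvg_linear_pool => i; exact: cc.
have [||||c cE] := @exists_cumulativeBounded R (linear_pool w (fun i => cs i)).
- move=> x y xy; apply: ler_sum => i _; rewrite ler_wpM2l//.
  exact: cumulativeBounded_nondecreasing.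
- exact: Lc.
- rewrite [X in _ --> X](_ : _ = \sum_(i < k) w i * 0).
    by apply: cvg_linear_pool => i; exact: cumulativeNy.
  by rewrite big1// => i _; rewrite mulr0.
- rewrite [X in _ --> X](_ : _ = \sum_(i < k) w i * 1).
    by apply: cvg_linear_pool => i; exact: cumulativey.
  by rewrite -[LHS]w1; apply: eq_bigr => i _; rewrite mulr1.
by exists c; split; [exact: cE|rewrite -cE].
Qed.

Lemma beta_linear_pool_maps_class (R : realType) (k : nat) (I : set R)
    (theta : blp_parameter R k) : is_interval I ->
  maps_class (cdf_class_plus I) (beta_linear_pool theta).
Proof.
move=> hI Fs CFs.
have w1 := blp_weight_sum1 theta; have w0 := blp_weight_ge0 theta.
have a0 := blp_alpha_gt0 theta; have b0 := blp_beta_gt0 theta.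
have [cs csP] := choice CFs.
have [c [cE cc]] : exists c : cumulativeBounded (0 : R) (1 : R),
    linear_pool (blp_weight theta) Fs = c /\ continuous c.
  rewrite (_ : Fs = fun i => cs i); last by apply/funext => i; have [] := csP i.
  by apply: linear_pool_cumulative => // i; have [<-] := csP i.
set B := beta_cdf (blp_alpha theta) (blp_beta theta).
have GE : beta_linear_pool theta Fs = B \o c by rewrite -cE.
have Bc : continuous B by exact: continuous_beta_cdf.
have Gc : continuous (B \o c).
  by move=> x; apply: continuous_comp; [exact: cc|exact: Bc].
have B0 : B 0 = 0 by exact: beta_cdf_le0.
have B1 : B 1 = 1 by exact: beta_cdf_ge1.
have [||||g gE] := @exists_cumulativeBounded R (B \o c).
- move=> x y xy; apply: beta_cdf_nondecreasing => //.
  exact: cumulativeBounded_nondecreasing.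
- exact: Gc.
- by rewrite -[X in _ --> X]B0; apply: (cvg_comp _ _ (cumulativeNy c)); exact: Bc.
- by rewrite -[X in _ --> X]B1; apply: (cvg_comp _ _ (cumulativey c)); exact: Bc.
rewrite GE gE; apply: cdf_class_plus_intro => //.
- by rewrite -gE.
- rewrite -gE => x y Ix Iy xy /=; apply: beta_cdf_increasing => //.
  + by rewrite in_itv/=; exact: cumulativeBounded_itv01.
  + by rewrite in_itv/=; exact: cumulativeBounded_itv01.
  + rewrite -cE; apply: linear_pool_lt => // i.
    by have [-> _ _ inc] := csP i; exact: inc.
- move=> x; rewrite -gE /= -cE => x01; apply: contrapT => nIx.
  have [h|h] := cdf_class_plus_outside hI nIx; move: x01;
    by rewrite (linear_pool_cst w1 (fun i => h _ (CFs i))) ?B0 ?B1 ltxx ?andbF.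
Qed.

Lemma beta_linear_pool_anonymous (R : realType) (k : nat) (C : set (R -> R))
    (theta : blp_parameter R k) (v : R) : (forall i, blp_weight theta i = v) ->
  anonymous C (beta_linear_pool theta).
Proof.
move=> wv Fs p _; apply/funext => y; rewrite /beta_linear_pool; congr beta_cdf.
rewrite [RHS](reindex_inj (@perm_inj _ p))/=.
by apply: eq_bigr => i _; rewrite !wv.
Qed.

(** * Neutral dispersion *)

Lemma pit_continuous (R : realType) (T : Type) (F : R -> R) (Y V : T -> R) :
  continuous F -> pit F Y V = F \o Y.
Proof.
move=> Fc; apply/funext => t; rewrite /pit.
have -> : lim (F y @[y --> (Y t)^'-]) = F (Y t).
  by apply: cvg_lim => //; apply: cvg_at_left_filter; exact: Fc.
by rewrite subrr mulr0 addr0.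
Qed.

(** Take [m] to be the value of the pool at a median [y0] of [c0]. As the pool is
    strictly monotone at [y0], it exceeds [m] exactly on [ ]y0, +oo[ ], so that
    [m] is a median of the pool under the law of [c0]. *)
Lemma exists_neutral_beta_parameters (R : realType) (k : nat) (I : set R) (w : 'I_k -> R)
    (Fs : 'I_k -> R -> R) (c0 : cumulativeBounded (0 : R) (1 : R)) :
  is_interval I -> cdf_class_plus I c0 -> (forall i, cdf_class_plus I (Fs i)) ->
  (forall i, 0 <= w i) -> \sum_(i < k) w i = 1 ->
  exists m s : R, [/\ 0 < m < 1, 0 < s &
    rvariance (lebesgue_stieltjes_measure c0)
      (fun y => beta_cdf_mp m s (linear_pool w Fs y)) = 12^-1].
Proof.
move=> hI Cc0 CFs w0 w1.
have [_ [_ _ cc0 _]] := Cc0.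
have [cs csP] := choice CFs.
have [c [cE cc]] : exists c : cumulativeBounded (0 : R) (1 : R),
    linear_pool w Fs = c /\ continuous c.
  rewrite (_ : Fs = fun i => cs i); last by apply/funext => i; have [] := csP i.
  by apply: linear_pool_cumulative => // i; have [<-] := csP i.
have strict y z : 0 < c0 y < 1 -> (z < y -> c z < c y) /\ (y < z -> c y < c z).
  move=> y01; rewrite -cE; split=> yz; apply: linear_pool_lt => // i.
    by have [h _] := cdf_class_plus_lt z hI Cc0 (CFs i) y01; exact: h.
  by have [_ h] := cdf_class_plus_lt z hI Cc0 (CFs i) y01; exact: h.
have c01 y : 0 < c0 y < 1 -> 0 < c y < 1.
  move=> y01; apply/andP; split.
    have [h _] := strict y (y - 1) y01.
    have /andP[h0 _] := cumulativeBounded_itv01 c (y - 1).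
    by apply: le_lt_trans h0 _; apply: h; rewrite ltrBlDr ltrDl.
  have [_ h] := strict y (y + 1) y01.
  have /andP[_ h1] := cumulativeBounded_itv01 c (y + 1).
  by apply: lt_le_trans h1; apply: h; rewrite ltrDl.
have half : 0 < (2^-1 : R) < 1 by rewrite invr_gt0 ltr0n invf_lt1// ltr1n.
have [y0 y0E] := cumulativeBounded_surj cc0 half.
have y001 : 0 < c0 y0 < 1 by rewrite y0E.
have [||||||s s0 sE] := @exists_beta_variance _ _ R (lebesgue_stieltjes_measure c0)
    c (c y0) 12^-1.
- exact: c01.
- by lra.
- exact: (continuous_measurable_fun cc).
- have [N [mN N0 sub]] := ae_cumulative_itv01 cc0; exists N; split => // y /= ncy.
  by apply: sub => /= /c01.
- rewrite (_ : [set y | c y = c y0] = [set y0]); first exact: stieltjes_set1.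
  apply/seteqP; split=> [y /= cy|y ->//].
  have [h1 h2] := strict y0 y y001.
  by have [/h1|/h2|//] := ltgtP y y0; rewrite cy ltxx.
- rewrite (_ : [set y | c y0 < c y] = `]y0, +oo[%classic).
    have -> : 2^-1 = 1 - c0 y0 by rewrite y0E; field.
    exact: stieltjes_itvoy.
  apply/seteqP; split=> y; rewrite /= in_itv/= andbT => h.
    by rewrite ltNge; apply/negP => /(cumulativeBounded_nondecreasing c); rewrite leNgt h.
  by have [_ ] := strict y0 y y001; apply.
by exists (c y0), s; split => //; [exact: c01|rewrite cE].
Qed.

Theorem theorem3p9 (R : realType) (k : nat) (hk : (2 <= k)%N)
    (I : set R) (hI : is_interval I) :
  exchangeably_flexibly_dispersive (@beta_linear_pool R k) (cdf_class_plus I).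
Proof.
split=> [theta|F0 Fs CF0 CFs]; first exact: beta_linear_pool_maps_class.
have k0 : (k%:R : R) != 0 by rewrite pnatr_eq0 -lt0n (leq_trans _ hk).
pose w : 'I_k -> R := fun=> k%:R^-1.
have w0 i : 0 <= w i by rewrite invr_ge0.
have w1 : \sum_(i < k) w i = 1.
  by rewrite /w sumr_const card_ord -[_ *+ k]mulr_natr mulVf.
have [c0 [F0E _ _ _]] := CF0; rewrite F0E in CF0.
have [m [s [/andP[m0 m1] s0 var]]] := exists_neutral_beta_parameters hI CF0 CFs w0 w1.
have a0 : 0 < s * m by rewrite mulr_gt0.
have b0 : 0 < s * (1 - m) by rewrite mulr_gt0// subr_gt0.
pose theta := BLPParameter w0 w1 a0 b0; exists theta; split.
  by apply: (@beta_linear_pool_anonymous _ _ _ _ k%:R^-1).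
move=> d T P Y V Yc _ _; rewrite F0E in Yc.
have [_ [_ _ Gc _]] := beta_linear_pool_maps_class theta hI CFs.
rewrite /neutrally_dispersed pit_continuous//.
have mG : measurable_fun setT (beta_linear_pool theta Fs).
  exact: continuous_measurable_fun.
have G01 y : 0 <= beta_linear_pool theta Fs y <= 1 by exact: beta_cdf_itv01.
rewrite variance_rvariance.
- by rewrite (rvariance_distribution Yc)// => [|y]; [congr EFin|have /andP[] := G01 y].
- exact: measurableT_comp.
- by move=> t /=; have /andP[h0 h1] := G01 (Y t); rewrite ger0_norm.
Qed.
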